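(* Let $W$ be any BMS channel and let $P_{\rm e}>0$. There is a constant $\beta>0$, depending only on $P_{\rm e}$ and $I(W)$, such that for every rate $0<R<I(W)$ there is a block-length $N=2^n$ with $$N\le \frac{\beta}{(I(W)-R)^{6}}$$ such that the polar code for $W$ of block-length $N$ and rate $R$ has block error probability at most $P_{\rm e}$ under successive cancellation decoding.
   Context: All logarithms are base $2$. A BMS channel $W:\{0,1\}\to\mathcal{Y}$ is a binary-input memoryless output-symmetric channel with discrete output alphabet $\mathcal{Y}$ and transition probabilities $W(y\mid x)$ (output-symmetric: there is an involution $\pi$ of $\mathcal{Y}$ with $W(y\mid 1)=W(\pi(y)\mid 0)$ for all $y$). Its capacity is $I(W)=1-H(W)$, where $H(W)=\sum_{y}W(y\mid 1)\log\frac{W(y\mid 1)+W(y\mid 0)}{W(y\mid 1)}$; its error probability is $E(W)=\sum_{y}W(y\mid 1)\bigl(\mathbf{1}_{\{W(y\mid 0)>W(y\mid 1)\}}+\tfrac12\mathbf{1}_{\{W(y\mid 0)=W(y\mid 1)\}}\bigr)$. Channel transform $W\mapsto(W^0,W^1)$ (both BMS): $W^0(y_1,y_2\mid x_1)=\sum_{x_2\in\{0,1\}}\tfrac12 W(y_1\mid x_1\oplus x_2)W(y_2\mid x_2)$, $W^1(y_1,y_2,x_1\mid x_2)=\tfrac12 W(y_1\mid x_1\oplus x_2)W(y_2\mid x_2)$. For $N=2^n$ and $0\le i\le N-1$ with binary expansion $b_1\cdots b_n$ ($b_1$ most significant), $W_N^{(i)}=(((W^{b_1})^{b_2})^{\cdots})^{b_n}$.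 Polar code of block-length $N=2^n$ and rate $R$: let $\mathcal{I}_{N,R}$ be the set of $NR$ (rounded up to an integer) indices $i$ with the smallest values $E(W_N^{(i)})$, ties broken arbitrarily. A vector $u\in\{0,1\}^N$ with $u_i=0$ for $i\notin\mathcal{I}_{N,R}$ and $(u_i)_{i\in\mathcal{I}_{N,R}}$ uniformly distributed information bits is encoded as $x=uG_n$ over $\mathbb{F}_2$, $G_n=\begin{bmatrix}1&0\\1&1\end{bmatrix}^{\otimes n}$ (so the generator matrix consists of the rows of $G_n$ indexed by $\mathcal{I}_{N,R}$), and $x$ is sent over $N$ independent uses of $W$, with output $y\in\mathcal{Y}^N$. Up to relabeling of outputs, $W_N^{(i)}$ is the channel from $u_i$ to $(y,u_0,\dots,u_{i-1})$ given by $2^{-(N-1)}\sum_{u_{i+1},\dots,u_{N-1}}\prod_{k}W(y_k\mid (uG_n)_k)$. The successive cancellation (SC) decoder computes, for $i=0,1,\dots,N-1$ in order, $\hat u_i=0$ if $i\notin\mathcal{I}_{N,R}$, and otherwise $\hat u_i$ is the value $v\in\{0,1\}$ maximizing $W_N^{(i)}(y,\hat u_0,\dots,\hat u_{i-1}\mid v)$ (ties broken by a fair coin). The block error probability is $\Pr(\hat u\ne u)$. *)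

(* Defs.v *)
From mathcomp Require Import all_boot all_order all_algebra.
From mathcomp Require Import all_classical all_reals all_analysis.
From mathcomp Require Import mxtens.

Set Implicit Arguments.
Unset Strict Implicit.
Unset Printing Implicit Defensive.

Import Order.TTheory GRing.Theory Num.Theory.

Local Open Scope classical_set_scope.
Local Open Scope ring_scope.

(* Transition probabilities [W x y] = W(y | x), with input alphabet 'F_2 (so that
   the XOR of two inputs is their sum) and countable output alphabet.  That W is
   a probability kernel is part of the predicate [bms]. *)
Record channel (R : realType) := Channel {
  out : countType;
  trans :> 'F_2 -> out -> R }.

Section Channels.
Variable R : realType.
Implicit Type W : channel R.

Definition log2 (x : R) : R := ln x / ln 2.

(* Sum over a countable alphabet; only used on nonnegative summable families. *)
Definition csum (T : countType) (f : T -> R) : R :=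
  fine (\esum_(y in [set: T]) (f y)%:E).

Definition bms W : Prop :=
  [/\ forall x y, 0 <= W x y,
      forall x, (\esum_(y in [set: out W]) (W x y)%:E = 1)%E
    & exists2 pi : out W -> out W,
        involutive pi & forall y, W 1 y = W 0 (pi y)].

(* A term with [W 1 y = 0] is 0, as usual. *)
Definition entropy W : R :=
  csum (fun y => W 1 y * log2 ((W 1 y + W 0 y) / W 1 y)).

Definition capacity W : R := 1 - entropy W.

Definition error_prob W : R :=
  csum (fun y => W 1 y *
    ((W 1 y < W 0 y)%R%:R + 2^-1 * (W 0 y == W 1 y)%R%:R)).

Definition transform0 W : channel R :=
  @Channel R (out W * out W)%type
    (fun x1 y => \sum_(x2 : 'F_2) 2^-1 * W (x1 + x2) y.1 * W x2 y.2).

Definition transform1 W : channel R :=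
  @Channel R (out W * out W * 'F_2)%type
    (fun x2 y => 2^-1 * W (y.2 + x2) y.1.1 * W x2 y.1.2).

Definition transform W (b : bool) : channel R :=
  if b then transform1 W else transform0 W.

(* Binary expansion b_1 ... b_n of i < 2 ^ n, most significant bit first. *)
Definition bits (n i : nat) : seq bool :=
  [seq odd (i %/ 2 ^ (n - j)) | j <- iota 1 n].

Definition polar_channel W (n i : nat) : channel R :=
  foldl transform W (bits n i).

End Channels.

Definition polar_kernel : 'M['F_2]_2 := \matrix_(i, j) (j <= i)%N%:R.

(* [^t] is the Kronecker power. *)
Definition polar_matrix (n : nat) : 'M['F_2]_(2 ^ n) := polar_kernel ^t n.

Section PolarCode.
Variables (R : realType) (W : channel R) (n : nat).
Local Notation N := (2 ^ n)%N.

(* The ceil(N r) indices with the smallest error probabilities; every way of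
   breaking ties gives an admissible A. *)
Definition info_set (r : R) (A : {set 'I_N}) : Prop :=
  #|A|%:Z = Num.ceil (N%:R * r) /\
  forall i j, i \in A -> j \notin A ->
    error_prob (polar_channel W n i) <= error_prob (polar_channel W n j).

Definition encode (u : 'rV['F_2]_N) : 'rV['F_2]_N := u *m polar_matrix n.

Definition block_trans (x : 'rV['F_2]_N) (y : {ffun 'I_N -> out W}) : R :=
  \prod_(k < N) W (x 0 k) (y k).

(* W_N^(i)(y, p_0, ..., p_(i-1) | v): the entries of p from index i on are not
   used. *)
Definition bit_likelihood (i : 'I_N) (y : {ffun 'I_N -> out W})
    (p : 'rV['F_2]_N) (v : 'F_2) : R :=
  2 ^- (N - 1) *
  \sum_(u : 'rV['F_2]_N |
        (u 0 i == v) && [forall j : 'I_N, (j < i)%N ==> (u 0 j == p 0 j)])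
    block_trans (encode u) y.

(* The coin c_i settles a tie at index i. *)
Definition sc_bit (A : {set 'I_N}) (y : {ffun 'I_N -> out W})
    (c p : 'rV['F_2]_N) (i : 'I_N) : 'F_2 :=
  if i \notin A then 0
  else if bit_likelihood i y p 1 < bit_likelihood i y p 0 then 0
  else if bit_likelihood i y p 0 < bit_likelihood i y p 1 then 1
  else c 0 i.

Definition sc_step (A : {set 'I_N}) (y : {ffun 'I_N -> out W})
    (c p : 'rV['F_2]_N) (i : 'I_N) : 'rV['F_2]_N :=
  \row_j if j == i then sc_bit A y c p i else p 0 j.

(* [enum 'I_N] lists the indices in increasing order. *)
Definition sc_decode (A : {set 'I_N}) (y : {ffun 'I_N -> out W})
    (c : 'rV['F_2]_N) : 'rV['F_2]_N :=
  foldl (sc_step A y c) 0 (enum 'I_N).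

Definition frozen (A : {set 'I_N}) (u : 'rV['F_2]_N) : bool :=
  [forall i, (i \notin A) ==> (u 0 i == 0)].

(* The information bits and the coins c are uniform and independent. *)
Definition block_error (A : {set 'I_N}) : R :=
  \sum_(u : 'rV['F_2]_N | frozen A u) 2 ^- #|A| *
  \sum_(c : 'rV['F_2]_N) 2 ^- N *
    csum (fun y => block_trans (encode u) y * (sc_decode A y c != u)%:R).

End PolarCode.

Lemma info_set_exists (R : realType) (W : channel R) (n : nat) (r : R) :
  0 <= r <= 1 -> exists A : {set 'I_(2 ^ n)}, info_set W r A.
Proof.
case/andP=> r0 r1.
pose E (i : 'I_(2 ^ n)) := error_prob (polar_channel W n i).
pose le := [rel i j | E i <= E j].
have letot : total le by move=> i j; exact: le_total.
have letr : transitive le by move=> j i k /=; exact: le_trans.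
pose s := sort le (enum 'I_(2 ^ n)).
have k0 : 0 <= Num.ceil ((2 ^ n)%:R * r) :> int.
  by rewrite -(ceil0 R) le_ceil// mulr_ge0// ler0n.
case hk : (Num.ceil ((2 ^ n)%:R * r)) k0 => [k|//] _.
have kle : (k <= 2 ^ n)%N.
  rewrite -lez_nat -hk ceil_le_int.
  by rewrite -[leRHS]mulr1 ler_wpM2l// ler0n.
have us : uniq s by rewrite sort_uniq enum_uniq.
have ss : size s = (2 ^ n)%N by rewrite size_sort size_enum_ord.
exists [set i in take k s]; split.
  by rewrite hk cardsE (card_uniqP _) ?take_uniq// size_takel// ss.
move=> i j; rewrite !inE => ik jk.
have : pairwise le s by rewrite -sorted_pairwise//; exact: sort_sorted.
rewrite -{1}(cat_take_drop k s) pairwise_cat => /andP[/allrelP h _].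
apply: (h i j) => //.
have : j \in s by rewrite mem_sort mem_enum.
by rewrite -{1}(cat_take_drop k s) mem_cat (negPf jk).
Qed.

(* Main.v *)
(* Write Z for the Bhattacharyya parameter and N = 2^n.  Since Z(W^1) = Z^2 and
   Z sqrt(2 - Z^2) <= Z(W^0) <= 2Z - Z^2, the potential (Z (1 - Z^2))^(2/3)
   shrinks on average by a factor 0.888 < 2^(-1/6) in one transform.  Adding a
   small multiple of (Z (1 - Z^2))^a with a tiny exponent a hardly affects this
   rate and keeps the potential above N^(-a), up to a constant factor, for Z of
   order 1/N.  Capacity is preserved on average and I <= (1 - Z^2) / ln 2, so the
   synthetic channels with error probability above Pe / N carry a total capacity
   of only O(N^(5/6)), and at least N (I(W) - c N^(-1/6)) channels are below that
   threshold.  The union bound over the information bits, decoded by a genie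
   that knows the true past, concludes. *)
Require Import Defs.
From mathcomp Require Import all_boot all_order all_algebra.
From mathcomp Require Import ring lra mxtens.
From mathcomp Require Import all_classical all_reals all_analysis.

Set Implicit Arguments.
Unset Strict Implicit.
Unset Printing Implicit Defensive.

Import Order.TTheory GRing.Theory Num.Theory.
Local Open Scope ring_scope.

(** * Sums of nonnegative families *)

(** The 2/3-power alone contracts fast enough, but it drops to about N^(-2/3) when Z is of order
    1/N, so comparing capacity with potential would lose a factor N^(2/3). The added term loses only
    N^a with 2^a <= 513/512, and 16/9 * 513/512 = 2 * 57/64 with (57/64)^6 just below 1/2: this last
    inequality is where the exponent 6 comes from.

    The output alphabets grow with each transform, so the estimates are proved for [stochastic]
    channels, in terms of quantities symmetric in the two inputs ([bhat], [sym_capacity]). The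
    involution is applied to the outputs of [W] itself: to equate [capacity] with [sym_capacity],
    and to make the genie-aided error independent of the transmitted word.

    [polar_channel] iterates transforms, whereas the decoder maximizes a marginal of the N-fold
    product channel. They are matched by induction on n through the first transform: it belongs to
    the most significant bit of the index, hence to the splitting of rows into a lower and an upper
    half. *)

Section HasCsum.
Variable R : realType.

(** [csum] goes through [fine], which turns an infinite sum into 0; this predicate also records that
    the sum is finite. *)
Definition has_csum (T : countType) (f : T -> R) (s : R) : Prop :=
  (forall y, 0 <= f y) /\ (\esum_(y in [set: T]) (f y)%:E = s%:E)%E.

Lemma has_csumE (T : countType) (f : T -> R) s : has_csum f s -> csum f = s.
Proof. by case=> _; rewrite /csum => ->. Qed.

Lemma has_csum_ge0 (T : countType) (f : T -> R) s : has_csum f s -> 0 <= s.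
Proof.
by case=> f0 e; rewrite -lee_fin -e esum_ge0// => y _; rewrite lee_fin.
Qed.

Lemma eq_has_csum (T : countType) (f g : T -> R) s :
  f =1 g -> has_csum f s -> has_csum g s.
Proof. by move=> /funext ->. Qed.

Lemma has_csum_uniq (T : countType) (f : T -> R) s t :
  has_csum f s -> has_csum f t -> s = t.
Proof. by move=> /has_csumE <- /has_csumE <-. Qed.

Lemma has_csumD (T : countType) (f g : T -> R) s t :
  has_csum f s -> has_csum g t -> has_csum (fun y => f y + g y) (s + t).
Proof.
move=> [f0 fs] [g0 gt]; split=> [y|]; first exact: addr_ge0.
by rewrite EFinD -fs -gt -esumD// => y _; rewrite lee_fin.
Qed.

Lemma has_csumZ (T : countType) (f : T -> R) c s :
  0 <= c -> has_csum f s -> has_csum (fun y => c * f y) (c * s).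
Proof.
rewrite le_eqVlt => /predU1P[<-|c0] [f0 fs]; split.
- by move=> y; rewrite mul0r.
- by rewrite mul0r; apply: esum1 => y _; rewrite mul0r.
- by move=> y; rewrite mulr_ge0// ltW.
(* One inequality suffices: the other is the same one for the factor [c^-1] and the family
   [c * f]. *)
have le_scale (d : R) (h : T -> R) : 0 < d ->
    (\esum_(y in [set: T]) (d * h y)%:E <=
     d%:E * \esum_(y in [set: T]) (h y)%:E)%E.
  move=> d0; apply: ge_ereal_sup => _ [X [finX XI]] <-.
  rewrite fsbig_finite//=.
  rewrite sumEFin -mulr_sumr EFinM -sumEFin.
  rewrite lee_pmul2l ?lte_fin//.
  by apply: esum_ge; exists X => //; rewrite fsbig_finite.
apply/eqP; rewrite eq_le EFinM -fs le_scale//=.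
rewrite -lee_pdivlMl//.
have := le_scale c^-1 (fun y => c * f y); rewrite invr_gt0 => /(_ c0).
by under eq_esum do rewrite mulKf ?gt_eqF//.
Qed.

Lemma le_has_csum (T : countType) (f g : T -> R) s t :
  has_csum f s -> has_csum g t -> (forall y, f y <= g y) -> s <= t.
Proof.
by move=> [_ fs] [_ gt] fg; rewrite -lee_fin -fs -gt le_esum// => y _; rewrite lee_fin.
Qed.

Lemma has_csum_dominated (T : countType) (f g : T -> R) t :
  (forall y, 0 <= f y <= g y) -> has_csum g t ->
  exists2 s, has_csum f s & s <= t.
Proof.
move=> fg [_ gt].
have f0 y : 0 <= f y by case/andP: (fg y).
have lefg : (\esum_(y in [set: T]) (f y)%:E <= t%:E)%E.
  by rewrite -gt le_esum// => y _; rewrite lee_fin; case/andP: (fg y).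
have ge0f : (0 <= \esum_(y in [set: T]) (f y)%:E)%E.
  by rewrite esum_ge0// => y _; rewrite lee_fin.
have fin : (\esum_(y in [set: T]) (f y)%:E)%E \is a fin_num.
  by rewrite ge0_fin_numE// (le_lt_trans lefg) ?ltry.
exists (fine (\esum_(y in [set: T]) (f y)%:E)%E); first by split; rewrite ?fineK.
by rewrite -lee_fin fineK.
Qed.

Lemma csum_bij (T T' : countType) (e : T -> T') (f : T' -> R) :
  bijective e -> csum f = csum (fun x => f (e x)).
Proof.
by move=> be; rewrite /csum (@reindex_esum _ _ _ setT setT e)// setTT_bijective.
Qed.

Lemma has_csum_bij (T T' : countType) (e : T -> T') (f : T' -> R) s :
  bijective e -> has_csum f s <-> has_csum (fun x => f (e x)) s.
Proof.
move=> bije; have E := @reindex_esum R T T' setT setT e (fun y => (f y)%:E).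
rewrite /has_csum E ?setTT_bijective//; split=> -[f0 ?]; split=> //.
by case: bije => e' _ e'K y; rewrite -(e'K y).
Qed.

Lemma swap_bij (T1 T2 : Type) :
  set_bij [set: T2 * T1] [set: T1 * T2] (fun p : T2 * T1 => (p.2, p.1)).
Proof.
by rewrite setTT_bijective; exists (fun p : T1 * T2 => (p.2, p.1)); case.
Qed.

(** Tonelli: an inner sum is one term of a nonnegative sum equal to [s], hence finite. *)
Lemma has_csum_pairP (T1 T2 : countType) (f : T1 * T2 -> R) s :
  has_csum f s ->
  exists2 g, (forall y2, has_csum (fun y1 => f (y1, y2)) (g y2)) & has_csum g s.
Proof.
move=> [f0 fs].
pose h y2 := (\esum_(y1 in [set: T1]) (f (y1, y2))%:E)%E.
have h0 y2 : (0 <= h y2)%E by apply: esum_ge0 => y1 _; rewrite lee_fin.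
have hs : (\esum_(y2 in [set: T2]) h y2 = s%:E)%E.
  rewrite -fs (@reindex_esum _ _ _ _ _ _ _ (@swap_bij T1 T2))/=.
  rewrite (_ : [set: T2 * T1] = setT `*`` (fun=> setT))%classic; last first.
    by apply/seteqP; split => -[].
  rewrite -(@esum_esum R T2 T1 setT (fun=> setT) (fun y2 y1 => (f (y1, y2))%:E))//.
  by move=> *; rewrite lee_fin.
have hfin y2 : h y2 \is a fin_num.
  rewrite ge0_fin_numE//; apply: (@le_lt_trans _ _ s%:E); last by rewrite ltry.
  rewrite -hs; apply: esum_ge; exists [set y2]%classic; first by split.
  by rewrite fsbig_set1.
exists (fun y2 => fine (h y2)) => [y2|]; first by split; rewrite ?fineK.
split=> [y2|]; first exact: fine_ge0.
by rewrite -hs; apply: eq_esum => y2 _; rewrite fineK.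
Qed.

Lemma has_csum_pair (T1 T2 : countType) (f : T1 * T2 -> R) g s :
  (forall y2, has_csum (fun y1 => f (y1, y2)) (g y2)) -> has_csum g s ->
  has_csum f s.
Proof.
move=> fg [g0 gs]; have f0 y : 0 <= f y by case: y => y1 y2; have [+ _] := fg y2.
split=> //; rewrite -gs.
rewrite (@reindex_esum _ _ _ _ _ _ _ (@swap_bij T1 T2))/=.
rewrite (_ : [set: T2 * T1] = setT `*`` (fun=> setT))%classic; last first.
  by apply/seteqP; split => -[].
rewrite -(@esum_esum R T2 T1 setT (fun=> setT) (fun y2 y1 => (f (y1, y2))%:E));
  last by move=> *; rewrite lee_fin.
by apply: eq_esum => y2 _; case: (fg y2).
Qed.

Lemma has_csum_mul (T1 T2 : countType) (f : T1 -> R) (g : T2 -> R) s t :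
  has_csum f s -> has_csum g t ->
  has_csum (fun y => f y.1 * g y.2) (s * t).
Proof.
move=> fs gt; have [g0 _] := gt.
apply: (has_csum_pair (g := fun y2 => s * g y2)).
  move=> y2; rewrite mulrC; have := has_csumZ (g0 y2) fs.
  by apply: eq_has_csum => y1 /=; rewrite mulrC.
by apply: has_csumZ => //; apply: has_csum_ge0 fs.
Qed.

Lemma has_csum_sum (T : countType) (I : Type) (r : seq I) (P : pred I)
    (f : I -> T -> R) (s : I -> R) :
  (forall i, has_csum (f i) (s i)) ->
  has_csum (fun y => \sum_(i <- r | P i) f i y) (\sum_(i <- r | P i) s i).
Proof.
move=> fs; elim: r => [|i r IH].
  rewrite big_nil; split=> [y|]; first by rewrite big_nil.
  by apply: esum1 => y _; rewrite big_nil.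
rewrite big_cons; case: ifP => Pi; last first.
  by apply: eq_has_csum IH => y; rewrite big_cons Pi.
by apply: eq_has_csum (has_csumD (fs i) IH) => y; rewrite big_cons Pi.
Qed.

Lemma has_csum_fin (I : finType) (f : I -> R) :
  (forall i, 0 <= f i) -> has_csum f (\sum_i f i).
Proof.
have finI : finite_set [set: I] by exact: finite_finset.
move=> f0; split=> //; rewrite esum_fset//; last by move=> *; rewrite lee_fin.
rewrite fsbig_finite//= -sumEFin; apply/esym.
rewrite -[RHS](@perm_big _ _ _ _ (index_enum I))//=.
apply: uniq_perm; rewrite ?index_enum_uniq ?finmap.fset_uniq//.
by move=> i; rewrite mem_index_enum in_fset_set// mem_set.
Qed.

Lemma has_csum_pair_fin (T : countType) (I : finType) (f : T * I -> R) s :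
  (forall i, has_csum (fun y => f (y, i)) (s i)) ->
  has_csum f (\sum_i s i).
Proof.
by move=> fs; apply: (has_csum_pair fs); apply: has_csum_fin => i; apply: has_csum_ge0 (fs i).
Qed.

(* Minkowski's inequality for the sum of the vectors [(f y, g y)]. *)
Lemma has_csum_norm (T : countType) (f g : T -> R) s t r :
  has_csum f s -> has_csum g t ->
  has_csum (fun y => Num.sqrt (f y ^+ 2 + g y ^+ 2)) r ->
  Num.sqrt (s ^+ 2 + t ^+ 2) <= r.
Proof.
move=> fs gt hr; have s0 := has_csum_ge0 fs; have t0 := has_csum_ge0 gt.
have r0 := has_csum_ge0 hr.
set C := Num.sqrt _.
have [->//|C0] := eqVneq C 0; have {}C0 : 0 < C by rewrite lt0r C0 sqrtr_ge0.
(* Multiplied by [C], the left-hand side is the sum of [s * f y + t * g y], and Cauchy-Schwarz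
   applies to each term. *)
rewrite -(ler_pM2l C0) -expr2 sqr_sqrtr ?addr_ge0 ?sqr_ge0// !expr2.
apply: le_has_csum (has_csumD (has_csumZ s0 fs)
  (has_csumZ t0 gt)) (has_csumZ (ltW C0) hr) _ => y.
rewrite /C -sqrtrM ?addr_ge0 ?sqr_ge0//.
apply: (le_trans (ler_norm _)); rewrite -sqrtr_sqr ler_sqrt; last first.
  by rewrite mulr_ge0// addr_ge0 ?sqr_ge0.
rewrite -subr_ge0 (_ : _ - _ = (s * g y - t * f y) ^+ 2) ?sqr_ge0//.
by rewrite !expr2; ring.
Qed.

End HasCsum.

(** * Bhattacharyya parameter and capacity under the transform *)

Section Bhattacharyya.
Variable R : realType.
Implicit Types (W : channel R) (a b c d : R).

Lemma sum_F2 (V : nmodType) (F : 'F_2 -> V) : \sum_x F x = F 0 + F 1.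
Proof.
rewrite (bigD1 0)//= (bigD1 1)//= big1 ?addr0// => -[[|[|]]] //.
Qed.

Lemma F2_cases (x : 'F_2) : x = 0 \/ x = 1.
Proof. by case: x => -[|[|//]] i; [left|right]; apply/val_inj. Qed.

Lemma F2_11 : 1 + 1 = 0 :> 'F_2.
Proof. exact/val_inj. Qed.

(** The invariant carried through the transforms; it spares the construction of an involution on
    each new alphabet. *)
Definition stochastic W : Prop :=
  (forall x y, 0 <= W x y) /\ (forall x, has_csum (W x) 1).

Lemma bms_stochastic W : bms W -> stochastic W.
Proof. by case=> W0 W1 _; split=> // x; split. Qed.

Lemma stochastic_transform W (b : bool) : stochastic W -> stochastic (transform W b).
Proof.
case=> W0 W1.
have half0 : 0 <= 2^-1 :> R by rewrite invr_ge0.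
have E : \sum_(x1 : 'F_2) 2^-1 * (1 * 1) = 1 :> R by rewrite sum_F2; lra.
case: b; split=> /= x.
- by move=> y; rewrite !mulr_ge0.
- rewrite -[X in has_csum _ X]E.
  apply: has_csum_pair_fin => x1.
  apply: eq_has_csum (has_csumZ half0 (has_csum_mul (W1 (x1 + x)) (W1 x))) => y.
  by rewrite /= mulrA.
- by move=> y; apply: sumr_ge0 => x2 _; rewrite !mulr_ge0.
- rewrite -[X in has_csum _ X]E.
  apply: has_csum_sum => x2.
  apply: eq_has_csum (has_csumZ half0 (has_csum_mul (W1 (x + x2)) (W1 x2))) => y.
  by rewrite /= mulrA.
Qed.

Definition bhat W : R := csum (fun y => Num.sqrt (W 0 y * W 1 y)).

Lemma has_csum_bhat W : stochastic W ->
  has_csum (fun y => Num.sqrt (W 0 y * W 1 y)) (bhat W) /\ bhat W <= 1.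
Proof.
move=> [W0 W1].
have half0 : 0 <= 2^-1 :> R by rewrite invr_ge0.
have := has_csumZ half0 (has_csumD (W1 0) (W1 1)).
have -> : 2^-1 * (1 + 1) = 1 :> R by lra.
move=> /has_csum_dominated h.
case: (h (fun y => Num.sqrt (W 0 y * W 1 y))) => [y|s hs s1].
  rewrite sqrtr_ge0/= -(@ler_pXn2r _ 2) ?nnegrE ?sqrtr_ge0//; last first.
    by rewrite mulr_ge0 ?invr_ge0// addr_ge0.
  rewrite sqr_sqrtr ?mulr_ge0//.
  by have := sqr_ge0 (W 0 y - W 1 y); move: (W 0 y) (W 1 y) => a b; clear; lra.
by rewrite /bhat (has_csumE hs).
Qed.

Lemma bhat_ge0 W : stochastic W -> 0 <= bhat W.
Proof. by move=> /has_csum_bhat[/has_csum_ge0]. Qed.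

Lemma bhat_transform1 W : stochastic W -> bhat (transform1 W) = bhat W ^+ 2.
Proof.
move=> kW; have [hB _] := has_csum_bhat kW; case: kW => W0 W1.
apply: has_csumE.
have -> : bhat W ^+ 2 = \sum_(x1 : 'F_2) 2^-1 * (bhat W * bhat W).
  by rewrite sum_F2; move: (bhat W) => b; clear; field.
apply: has_csum_pair_fin => x1 /=.
apply: eq_has_csum (has_csumZ _ (has_csum_mul hB hB)); last by rewrite invr_ge0.
move=> -[y1 y2] /=; rewrite -sqrtrM ?mulr_ge0//.
have {1}-> : 2^-1 = Num.sqrt (2^-1 * 2^-1) :> R by rewrite sqrtr_sqr// ger0_norm ?invr_ge0.
rewrite -sqrtrM ?mulr_ge0 ?invr_ge0//; congr Num.sqrt.
case: (F2_cases x1) => ->; rewrite ?addr0 ?add0r ?F2_11; ring.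
Qed.

Lemma transform0E W y1 y2 :
  (transform0 W 0 (y1, y2) = 2^-1 * (W 0 y1 * W 0 y2 + W 1 y1 * W 1 y2)) *
  (transform0 W 1 (y1, y2) = 2^-1 * (W 1 y1 * W 0 y2 + W 0 y1 * W 1 y2)).
Proof. by split; rewrite /= sum_F2 ?addr0 ?add0r ?F2_11; ring. Qed.

Lemma sqrt_transform0 W y1 y2 : stochastic W ->
  Num.sqrt (transform0 W 0 (y1, y2) * transform0 W 1 (y1, y2)) =
  2^-1 * Num.sqrt ((W 0 y1 * W 0 y2 + W 1 y1 * W 1 y2) *
                   (W 1 y1 * W 0 y2 + W 0 y1 * W 1 y2)).
Proof.
move=> [W0 _]; rewrite !transform0E.
have {3}-> : 2^-1 = Num.sqrt (2^-1 * 2^-1) :> R by rewrite sqrtr_sqr// ger0_norm ?invr_ge0.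
by rewrite -sqrtrM ?mulr_ge0 ?invr_ge0//; congr Num.sqrt; ring.
Qed.

(** Summed over both outputs, this is 2 Z(W^0) + 2 Z^2 <= 4 Z. In terms of the square roots p, q, r,
    s of a, b, c, d, the two squares to be compared differ by 2pqrs (p - q)^2 (r - s)^2. *)
Lemma sqrt_mix_le a b c d : 0 <= a -> 0 <= b -> 0 <= c -> 0 <= d ->
  Num.sqrt ((a * c + b * d) * (b * c + a * d)) + 2 * (Num.sqrt (a * b) * Num.sqrt (c * d))
  <= Num.sqrt (a * b) * (c + d) + (a + b) * Num.sqrt (c * d).
Proof.
move=> a0 b0 c0 d0; rewrite (sqrtrM b a0) (sqrtrM d c0).
move: (sqr_sqrtr a0) (sqr_sqrtr b0) (sqr_sqrtr c0) (sqr_sqrtr d0).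
move: (sqrtr_ge0 a) (sqrtr_ge0 b) (sqrtr_ge0 c) (sqrtr_ge0 d).
move: (Num.sqrt a) (Num.sqrt b) (Num.sqrt c) (Num.sqrt d) => p q r s p0 q0 r0 s0 <- <- <- <-.
have T0 : 0 <= p * q * (r - s) ^+ 2 + r * s * (p ^+ 2 + q ^+ 2).
  apply: addr_ge0; apply: mulr_ge0; rewrite ?sqr_ge0 ?(mulr_ge0 p0 q0) ?(mulr_ge0 r0 s0)//.
  by rewrite addr_ge0 ?sqr_ge0.
rewrite -lerBrDr; apply: (@le_trans _ _ (p * q * (r - s) ^+ 2 + r * s * (p ^+ 2 + q ^+ 2)));
  last by rewrite le_eqVlt; apply/orP; left; apply/eqP; ring.
rewrite -(@ler_pXn2r _ 2) ?nnegrE ?sqrtr_ge0// sqr_sqrtr; last first.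
  by apply: mulr_ge0; apply: addr_ge0; apply: mulr_ge0; rewrite sqr_ge0.
rewrite -subr_ge0 (_ : _ - _ = 2 * (p * q * (r * s)) * (p - q) ^+ 2 * (r - s) ^+ 2); last by ring.
by do 2 (apply: mulr_ge0; rewrite ?sqr_ge0//); rewrite !mulr_ge0.
Qed.

Lemma bhat_transform0_le W : stochastic W -> bhat (transform0 W) <= 2 * bhat W - bhat W ^+ 2.
Proof.
move=> kW; have [hB _] := has_csum_bhat kW; have [hB0 _] := has_csum_bhat (stochastic_transform false kW).
have [W0 W1] := kW; have B0 := bhat_ge0 kW.
have hS : has_csum (fun y => W 0 y + W 1 y) (1 + 1) by apply: has_csumD.
have lhs := has_csumD (has_csumZ (ler0n R 2) hB0) (has_csumZ (ler0n R 2) (has_csum_mul hB hB)).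
have rhs := has_csumD (has_csum_mul hB hS) (has_csum_mul hS hB).
have := le_has_csum lhs rhs; rewrite -/(transform0 W) => H.
suff : 2 * bhat (transform0 W) + 2 * (bhat W * bhat W) <= bhat W * (1 + 1) + (1 + 1) * bhat W.
  by move: (bhat _) (bhat W) => x y; clear; lra.
apply: H => -[y1 y2]; rewrite /transform sqrt_transform0// mulVKf ?pnatr_eq0//.
exact: sqrt_mix_le.
Qed.

(* Minkowski's inequality, applied to the sum over y1 and then over y2. *)
Lemma bhat_transform0_ge W : stochastic W ->
  bhat W ^+ 2 * (2 - bhat W ^+ 2) <= bhat (transform0 W) ^+ 2.
Proof.
move=> kW; have [hB B1] := has_csum_bhat kW.
have [hB0 _] := has_csum_bhat (stochastic_transform false kW).
have [W0 W1] := kW; have B0 := bhat_ge0 kW.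
rewrite /transform in hB0; set Z := bhat W in hB B0 B1 *; set Z0 := bhat (transform0 W) in hB0 *.
have Z00 := has_csum_ge0 hB0.
have Z21 : 0 <= 1 - Z ^+ 2 by rewrite subr_ge0 expr_le1.
have hS : has_csum (fun y => W 0 y + W 1 y) (1 + 1) by apply: has_csumD.
pose Q y2 := Num.sqrt (W 0 y2 * W 1 y2).
have [F hF hFs] := has_csum_pairP hB0.
(* With a, b the likelihoods of [y1] and c, d those of [y2], (ac + bd)(bc + ad) = cd(a + b)^2 + ab(c
   - d)^2 is the squared norm of a vector whose sum over [y1] is (2 sqrt(cd), Z|c - d|). Writing 4cd
   + Z^2(c - d)^2 as 4cd(1 - Z^2) + Z^2(c + d)^2 gives a vector whose sum over [y2] is again
   explicit, with squared norm 4Z^2(1 - Z^2) + 4Z^2. *)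
have FQ y2 : Num.sqrt ((2 * Num.sqrt (1 - Z ^+ 2) * Q y2) ^+ 2 + (Z * (W 0 y2 + W 1 y2)) ^+ 2)
    <= 2 * F y2.
  have P0 : 0 <= W 0 y2 * W 1 y2 by rewrite mulr_ge0.
  have D0 : 0 <= `|W 0 y2 - W 1 y2| by [].
  have := has_csum_norm (has_csumZ (sqrtr_ge0 _ : 0 <= Q y2) hS) (has_csumZ D0 hB)
    (r := 2 * F y2).
  rewrite (_ : (Q y2 * _) ^+ 2 + _ =
    (2 * Num.sqrt (1 - Z ^+ 2) * Q y2) ^+ 2 + (Z * (W 0 y2 + W 1 y2)) ^+ 2); last first.
    rewrite !exprMn real_normK ?num_real// !sqr_sqrtr//; ring.
  apply; apply: eq_has_csum (has_csumZ _ (hF y2)); last by [].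
  move=> y1 /=; rewrite -/(transform0 W) sqrt_transform0// mulVKf ?pnatr_eq0//; congr Num.sqrt.
  rewrite !exprMn real_normK ?num_real// !sqr_sqrtr ?mulr_ge0//; ring.
have h2 := has_csumZ (ler0n R 2) hFs.
have hQ : has_csum (fun y => 2 * Num.sqrt (1 - Z ^+ 2) * Q y) (2 * Num.sqrt (1 - Z ^+ 2) * Z).
  by apply: has_csumZ => //; rewrite mulr_ge0 ?sqrtr_ge0.
have hZS := has_csumZ B0 hS.
have [r hr rle] := has_csum_dominated (fun y => introT andP (conj (sqrtr_ge0 _) (FQ y))) h2.
have := le_trans (has_csum_norm hQ hZS hr) rle.
rewrite -(@ler_pXn2r _ 2) ?nnegrE ?sqrtr_ge0 ?mulr_ge0// sqr_sqrtr; last first.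
  by rewrite addr_ge0 ?sqr_ge0.
rewrite !exprMn sqr_sqrtr//.
by move: (Z ^+ 2) (Z0 ^+ 2) => u v; clear; lra.
Qed.

Lemma error_prob_le_bhat W : stochastic W -> error_prob W <= bhat W.
Proof.
move=> kW; have [hB _] := has_csum_bhat kW; have [W0 W1] := kW.
have fB y : 0 <= W 1 y * ((W 1 y < W 0 y)%R%:R + 2^-1 * (W 0 y == W 1 y)%R%:R)
    <= Num.sqrt (W 0 y * W 1 y).
  move: (W0 0 y) (W0 1 y) => /=; move: (W 0 y) (W 1 y) => a b a0 b0.
  case: (ltgtP b a) => [ba|ab|->]; rewrite /= ?mulr0 ?addr0 ?mulr1 ?add0r ?mulr0.
  - rewrite b0/= -[leLHS](ger0_norm b0) -sqrtr_sqr ler_sqrt ?mulr_ge0//.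
    by rewrite expr2 ler_wpM2r// ltW.
  - by rewrite lexx sqrtr_ge0.
  - rewrite mulr_ge0 ?invr_ge0//= -expr2 sqrtr_sqr ger0_norm//.
    by rewrite -[leRHS]mulr1 ler_wpM2l// invf_le1// ler1n.
have [s hs sB] := has_csum_dominated fB hB.
by rewrite /error_prob (has_csumE hs).
Qed.

End Bhattacharyya.

(** * Entropy of a uniform input given the output *)

Section Entropy.
Variable R : realType.
Implicit Types (W : channel R) (a b c d : R).

Lemma ln2_gt0 : 0 < ln 2 :> R.
Proof. by rewrite ln_gt0// ltr1n. Qed.

Definition xlnx (x : R) := x * ln x.

(* [joint_ent (W 0 y) (W 1 y)] is 2 P(y) H(X | y) in nats, with X uniform. *)
Definition joint_ent a b := xlnx (a + b) - xlnx a - xlnx b.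

Lemma xlnxM (x y : R) : 0 <= x -> 0 <= y -> xlnx (x * y) = x * xlnx y + y * xlnx x.
Proof.
rewrite /xlnx !le_eqVlt => /predU1P[<-|x0]; first by rewrite !mul0r mulr0 addr0.
move=> /predU1P[<-|y0]; first by rewrite !(mulr0, mul0r) addr0.
by rewrite lnM ?posrE//; ring.
Qed.

Lemma joint_entE a b : 0 <= a -> 0 <= b ->
  joint_ent a b = a * ln ((a + b) / a) + b * ln ((b + a) / b).
Proof.
have E (u v : R) : 0 <= u -> 0 <= v -> u * ln ((u + v) / u) = u * ln (u + v) - u * ln u.
  rewrite le_eqVlt => /predU1P[<- _|u0 v0]; first by rewrite !mul0r subr0.
  by rewrite ln_div ?posrE ?ltr_wpDr// mulrBr.
move=> a0 b0; rewrite E// E// [b + a]addrC /joint_ent /xlnx; ring.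
Qed.

Lemma cond_ent_bounds a b : 0 <= a -> 0 <= b -> 0 <= b * ln ((b + a) / b) <= a.
Proof.
move=> a0; rewrite le_eqVlt => /predU1P[<-|b0]; first by rewrite mul0r lexx.
have E : (b + a) / b = 1 + a / b by rewrite mulrDl divff ?gt_eqF.
have ab0 : 0 <= a / b by rewrite divr_ge0// ltW.
rewrite E mulr_ge0 ?(ltW b0) ?ln_ge0 ?lerDl//=.
have := @le_ln1Dx R (a / b); rewrite (lt_le_trans _ ab0) ?ltrN10// => /(_ isT) le.
apply: le_trans (ler_wpM2l (ltW b0) le) _.
by rewrite mulrCA divff ?gt_eqF// mulr1.
Qed.

Lemma joint_ent_bounds a b : 0 <= a -> 0 <= b -> 0 <= joint_ent a b <= a + b.
Proof.
move=> a0 b0; rewrite joint_entE//.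
have /andP[h1 h2] := cond_ent_bounds a0 b0.
have /andP[h3 h4] := cond_ent_bounds b0 a0.
by rewrite addr_ge0//= addrC lerD.
Qed.

(** The bound ln x <= x - 1 at 2a/(a+b) and 2b/(a+b) gives [joint_ent a b] >= (a+b) ln 2 + 4ab/(a+b)
    - (a+b). The parameter [z] replaces 4ab/(a+b) by a lower bound linear in sqrt(ab), which can be
    summed over the outputs; the choice z = Z then yields I <= (1 - Z^2) / ln 2. *)
Lemma joint_ent_ge a b z : 0 <= a -> 0 <= b -> 0 <= z ->
  (a + b) * ln 2 + 4 * (z * Num.sqrt (a * b)) <=
  joint_ent a b + (1 + z ^+ 2) * (a + b).
Proof.
move=> a0 b0 z0; rewrite joint_entE//.
have [ab0|ab0] := eqVneq (a + b) 0.
  have -> : a = 0 by apply/eqP; rewrite eq_le a0 andbT -ab0 lerDl.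
  have -> : b = 0 by apply/eqP; rewrite eq_le b0 andbT -ab0 lerDr.
  by rewrite !(mul0r, mulr0, addr0, sqrtr0).
have {}ab0 : 0 < a + b by rewrite lt0r ab0 addr_ge0.
have L (u v : R) : 0 <= u -> 0 <= v -> 0 < u + v ->
    u * ln 2 + u - 2 * u ^+ 2 / (u + v) <= u * ln ((u + v) / u).
  rewrite le_eqVlt => /predU1P[<- _ _|u0 v0 uv].
    by rewrite !mul0r expr0n/= mulr0 mul0r subr0 addr0.
  have q0 : 0 < 2 * u / (u + v) by rewrite divr_gt0// mulr_gt0.
  have := @le_ln1Dx R (2 * u / (u + v) - 1); rewrite ltrBrDr addNr q0 => /(_ isT).
  rewrite addrC subrK -mulrA lnM ?posrE//; last by rewrite divr_gt0.
  have -> : ln (u / (u + v)) = - ln ((u + v) / u).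
    by rewrite -lnV ?posrE ?divr_gt0// invf_div.
  move=> /(ler_wpM2l (ltW u0)).
  have -> : 2 * u ^+ 2 / (u + v) = u * (2 * (u / (u + v))) by rewrite expr2 -!mulrA; ring.
  by clear; lra.
have h1 := L _ _ a0 b0 ab0; have := L _ _ b0 a0; rewrite [b + a]addrC => /(_ ab0) h2.
have h3 : 4 * (z * Num.sqrt (a * b)) <= 4 * (a * b) / (a + b) + z ^+ 2 * (a + b).
  have -> : 4 * (a * b) / (a + b) = 4 * Num.sqrt (a * b) ^+ 2 / (a + b).
    by rewrite sqr_sqrtr ?mulr_ge0.
  rewrite -subr_ge0 (_ : _ - _ = (2 * Num.sqrt (a * b) - z * (a + b)) ^+ 2 / (a + b)).
    by rewrite divr_ge0 ?sqr_ge0// ltW.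
  by field; rewrite gt_eqF.
have h4 : 4 * (a * b) / (a + b) + 2 * a ^+ 2 / (a + b) + 2 * b ^+ 2 / (a + b) = 2 * (a + b).
  by field; rewrite gt_eqF.
by move: h1 h2 h3 h4; clear; lra.
Qed.

(** Chain rule for the two inputs given the two outputs: the terms [xlnx (2^-1 * (a * c + b * d))]
    and [xlnx (2^-1 * (b * c + a * d))] cancel between the two transforms, and [xlnxM] expands the
    rest. *)
Lemma joint_ent_transform a b c d : 0 <= a -> 0 <= b -> 0 <= c -> 0 <= d ->
  joint_ent (2^-1 * (a * c + b * d)) (2^-1 * (b * c + a * d)) +
  (joint_ent (2^-1 * (a * c)) (2^-1 * (b * d)) +
   joint_ent (2^-1 * (b * c)) (2^-1 * (a * d))) =
  2^-1 * ((a + b) * joint_ent c d) + 2^-1 * (joint_ent a b * (c + d)).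
Proof.
move=> a0 b0 c0 d0; rewrite /joint_ent -!mulrDr.
have -> : a * c + b * d + (b * c + a * d) = (a + b) * (c + d) by ring.
have h0 : 0 <= 2^-1 :> R by rewrite invr_ge0.
rewrite (xlnxM h0 (mulr_ge0 (addr_ge0 a0 b0) (addr_ge0 c0 d0))).
rewrite (xlnxM h0 (mulr_ge0 a0 c0)) (xlnxM h0 (mulr_ge0 b0 d0)).
rewrite (xlnxM h0 (mulr_ge0 b0 c0)) (xlnxM h0 (mulr_ge0 a0 d0)).
rewrite (xlnxM (addr_ge0 a0 b0) (addr_ge0 c0 d0)) !xlnxM ?addr_ge0 ?mulr_ge0//.
by ring.
Qed.

(** [entropy] sums over input 1 only; with both inputs present, the chain rule holds output by
    output. The value is twice the conditional entropy in nats, hence the divisor [2 * ln 2]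
    below. *)
Definition sym_ent W : R := csum (fun y => joint_ent (W 0 y) (W 1 y)).

Lemma has_csum_sym_ent W : stochastic W ->
  has_csum (fun y => joint_ent (W 0 y) (W 1 y)) (sym_ent W).
Proof.
move=> [W0 W1].
have [s hs _] := has_csum_dominated (fun y => joint_ent_bounds (W0 0 y) (W0 1 y))
  (has_csumD (W1 0) (W1 1)).
by rewrite /sym_ent (has_csumE hs).
Qed.

Lemma sym_ent_transform W : stochastic W ->
  sym_ent (transform0 W) + sym_ent (transform1 W) = 2 * sym_ent W.
Proof.
move=> kW; have h := has_csum_sym_ent kW.
have [W0 W1] := kW.
have h0 := has_csum_sym_ent (stochastic_transform false kW).
have [g hg /has_csum_uniq hs] := has_csum_pairP (has_csum_sym_ent (stochastic_transform true kW)).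
have g0 x : 0 <= g x := has_csum_ge0 (hg x).
rewrite (hs _ (has_csum_fin g0)) sum_F2.
have half0 : 0 <= 2^-1 :> R by rewrite invr_ge0.
have hS : has_csum (fun y => W 0 y + W 1 y) (1 + 1) by apply: has_csumD.
have lhs := has_csumD h0 (has_csumD (hg 0) (hg 1)).
have rhs := has_csumD (has_csumZ half0 (has_csum_mul hS h)) (has_csumZ half0 (has_csum_mul h hS)).
have := has_csum_uniq lhs (eq_has_csum _ rhs) => ->; first by lra.
move=> -[y1 y2]; rewrite /transform !transform0E /= -joint_ent_transform//.
by rewrite ?addr0 ?add0r ?F2_11 -!mulrA.
Qed.

Definition sym_capacity W : R := 1 - sym_ent W / (2 * ln 2).

(** The involution maps the part of [sym_ent] due to input 1 onto the part due to input 0. *)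
Lemma sym_capacityE W : bms W -> capacity W = sym_capacity W.
Proof.
move=> bW; have kW := bms_stochastic bW; case: (bW) => W0 _ [pi piK pi1].
have [_ W1] := kW.
have B y := cond_ent_bounds (W0 0 y) (W0 1 y).
have [s hs _] := has_csum_dominated B (W1 0).
have hs' : has_csum (fun y => W 0 y * ln ((W 0 y + W 1 y) / W 0 y)) s.
  have pib : bijective pi by exists pi.
  apply: eq_has_csum ((has_csum_bij _ _ pib).1 hs) => y /=.
  by rewrite !pi1 piK.
rewrite /capacity /sym_capacity; congr (1 - _).
have -> : sym_ent W = s + s.
  apply: has_csumE; apply: eq_has_csum (has_csumD hs' hs) => y.
  by rewrite joint_entE.
have l2 := ln2_gt0.
rewrite /entropy; transitivity ((ln 2)^-1 * s); last by field; rewrite gt_eqF.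
apply: has_csumE; apply: eq_has_csum (has_csumZ _ hs); last by rewrite invr_ge0 ltW.
by move=> y; rewrite /log2; ring.
Qed.

Lemma sym_capacity_transform W : stochastic W ->
  sym_capacity (transform0 W) + sym_capacity (transform1 W) = 2 * sym_capacity W.
Proof.
move=> /sym_ent_transform E; rewrite /sym_capacity.
have -> : sym_ent (transform0 W) = 2 * sym_ent W - sym_ent (transform1 W) by rewrite -E addrK.
by field; rewrite gt_eqF// ln2_gt0.
Qed.

Lemma sym_capacity_le1 W : stochastic W -> sym_capacity W <= 1.
Proof.
move=> /has_csum_sym_ent/has_csum_ge0 h.
by rewrite lerBlDr lerDl divr_ge0// mulr_ge0// ltW// ln2_gt0.
Qed.

Lemma sym_capacity_le W : stochastic W -> sym_capacity W <= (1 - bhat W ^+ 2) / ln 2.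
Proof.
move=> kW; have [hB _] := has_csum_bhat kW; have h := has_csum_sym_ent kW.
have B0 := bhat_ge0 kW; have [W0 W1] := kW; have l2 := ln2_gt0.
have hS : has_csum (fun y => W 0 y + W 1 y) (1 + 1) by apply: has_csumD.
have c0 : 0 <= 1 + bhat W ^+ 2 by rewrite addr_ge0 ?sqr_ge0.
have lhs := has_csumD (has_csumZ (ltW l2) hS) (has_csumZ (ler0n R 4) (has_csumZ B0 hB)).
have rhs := has_csumD h (has_csumZ c0 hS).
have := le_has_csum lhs rhs => H.
have {}H : ln 2 * (1 + 1) + 4 * (bhat W * bhat W) <= sym_ent W + (1 + bhat W ^+ 2) * (1 + 1).
  by apply: H => y; rewrite [ln 2 * _]mulrC; apply: joint_ent_ge.
rewrite /sym_capacity -subr_ge0.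
rewrite (_ : _ - _ = (sym_ent W + (1 + bhat W ^+ 2) * (1 + 1) -
  (ln 2 * (1 + 1) + 4 * (bhat W * bhat W))) / (2 * ln 2)); last first.
  by field; rewrite gt_eqF.
by rewrite divr_ge0 ?subr_ge0// mulr_ge0// ltW.
Qed.

End Entropy.

(** * The potential *)

Section Potential.
Variable R : realType.
Implicit Types x y z a b : R.

Definition weight z : R := z * (1 - z ^+ 2).

Lemma le_weight a b : 0 <= a <= b -> 3 * b ^+ 2 <= 1 -> weight a <= weight b.
Proof.
move=> /andP[a0 ab] b3; rewrite -subr_ge0 /weight.
rewrite (_ : _ - _ = (b - a) * (1 - (b ^+ 2 + b * a + a ^+ 2))); last by ring.
have h1 : b * a <= b ^+ 2 by rewrite expr2 ler_wpM2l// (le_trans a0).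
have h2 : a ^+ 2 <= b * a by rewrite expr2 ler_wpM2r.
by rewrite mulr_ge0//; lra.
Qed.

Lemma ge_weight a b : 0 <= a <= b -> 1 <= 3 * a ^+ 2 -> weight b <= weight a.
Proof.
move=> /andP[a0 ab] a3; rewrite -subr_ge0 /weight.
rewrite (_ : _ - _ = (b - a) * (b ^+ 2 + b * a + a ^+ 2 - 1)); last by ring.
have h1 : b * a <= b ^+ 2 by rewrite expr2 ler_wpM2l// (le_trans a0).
have h2 : a ^+ 2 <= b * a by rewrite expr2 ler_wpM2r.
by rewrite mulr_ge0//; lra.
Qed.

Lemma powR_two_thirds x k : 0 <= x -> 0 < k ->
  x `^ (2 / 3) <= 2 / 3 / k * x + k ^+ 2 / 3.
Proof.
move=> x0 k0; pose c := x `^ (3^-1).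
have c0 : 0 <= c by exact: powR_ge0.
have c3 : c ^+ 3 = x.
  by rewrite -powR_mulrn// -powRrM mulVf ?powRr1// pnatr_eq0.
have c2 : x `^ (2 / 3) = c ^+ 2.
  by rewrite -powR_mulrn// -powRrM mulrC.
rewrite c2 -c3 -subr_ge0.
rewrite (_ : _ - _ = (c - k) ^+ 2 * (2 * c + k) / (3 * k)); last by field; rewrite gt_eqF.
by apply: divr_ge0; [apply: mulr_ge0; [exact: sqr_ge0|]|]; lra.
Qed.

Lemma bernstein4_ge0 z l u : l <= z <= u ->
  [/\ 0 <= (u - z) ^+ 4, 0 <= (z - l) * (u - z) ^+ 3,
      0 <= (z - l) ^+ 2 * (u - z) ^+ 2, 0 <= (z - l) ^+ 3 * (u - z)
    & 0 <= (z - l) ^+ 4].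
Proof.
move=> /andP[]; rewrite -subr_ge0 -[z <= u]subr_ge0 => lz zu.
by split; rewrite ?mulr_ge0 ?exprn_ge0.
Qed.

(* Tangent lines of x^(2/3) at k^3 bound the left-hand side by polynomials, whose
   inequalities hold coefficientwise in the Bernstein basis of each piece.  The
   breakpoints 17/50 and 43/100 enclose the values of z for which the interval of
   possible y contains 1/sqrt 3, where [weight] is maximal. *)
Lemma weight_transforms z y : 0 <= z <= 1 -> 0 <= y -> y <= 2 * z - z ^+ 2 ->
    z ^+ 2 * (2 - z ^+ 2) <= y ^+ 2 ->
  exists B, [/\ 0 <= B, weight y <= B * weight z &
   (z + z ^+ 3) `^ (2 / 3) + B `^ (2 / 3) <= 222 / 125].
Proof.
move=> /andP[z0 z1] y0 yu yl.
have A0 : 0 <= z + z ^+ 3 by rewrite addr_ge0// exprn_ge0.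
have [zs|zs] := leP z (17 / 50).
  (* [weight (2 * z - z ^+ 2) / weight z] is (2 - z) times the series 1 - 3z^2 + 4z^3 - 4z^4 + ...;
     cutting it after z^3 leaves an upper bound. *)
  exists ((2 - z) * (1 - 3 * z ^+ 2 + 4 * z ^+ 3)).
  have B0 : 0 <= (2 - z) * (1 - 3 * z ^+ 2 + 4 * z ^+ 3).
    by rewrite mulr_ge0//; [lra|nra].
  split=> //.
    have h1 : weight y <= weight (2 * z - z ^+ 2).
      apply: le_weight; first by rewrite y0.
      have h0 : 0 <= 2 * z - z ^+ 2 := le_trans y0 yu.
      have h1 : 2 * z - z ^+ 2 <= 57 / 100.
        clear -z0 zs.
        have : 0 <= (17 / 50 - z) * (83 / 50 - z) by apply: mulr_ge0; lra.
        lra.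
      have : (2 * z - z ^+ 2) ^+ 2 <= (57 / 100) ^+ 2 by rewrite lerXn2r ?nnegrE//; lra.
      by clear; move: ((2 * z - z ^+ 2) ^+ 2) => h; lra.
    apply: (le_trans h1); rewrite -subr_ge0 /weight.
    rewrite (_ : _ - _ = 4 * z ^+ 5 * (1 - z) * (2 - z)); last by ring.
    by rewrite !mulr_ge0 ?exprn_ge0//; lra.
  have := powR_two_thirds (k := 3 / 5) A0; have := powR_two_thirds (k := 23 / 20) B0.
  move=> /(_ ltac:(lra)) h1 /(_ ltac:(lra)) h2; apply: le_trans (lerD h2 h1) _.
  have [] := @bernstein4_ge0 z 0 (17 / 50); first by rewrite z0 zs.
  by clear; lra.
(* The maximum 2/(3 sqrt 3) is about 0.385; 11/19 lies just above its location 1/sqrt 3, and the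
   nonnegative cubic expresses tangency there. *)
have w39 : weight y <= 39 / 100.
  have : 0 <= (y - 11 / 19) ^+ 2 * (y + 22 / 19) by rewrite mulr_ge0 ?sqr_ge0//; lra.
  by rewrite /weight; clear -y0; lra.
have [zm|zm] := leP z (43 / 100).
  (* On a short interval a constant [B] is enough: [weight y] is at most 39/100, [weight z] is at
     least its value at the left end, and [c] is the right end. *)
  have mid c B kA kB : 0 < B -> 0 < kA -> 0 < kB -> weight z >= 39 / 100 / B ->
      z <= c -> 2 / 3 / kA * (c + c ^+ 3) + kA ^+ 2 / 3 +
      (2 / 3 / kB * B + kB ^+ 2 / 3) <= 222 / 125 ->
    exists B, [/\ 0 <= B, weight y <= B * weight z &
      (z + z ^+ 3) `^ (2 / 3) + B `^ (2 / 3) <= 222 / 125].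
    move=> B0 kA0 kB0 wz zc le; exists B; split; first exact: ltW.
      by apply: (le_trans w39); rewrite [B * _]mulrC -ler_pdivrMr.
    apply: le_trans le; apply: lerD; last exact: powR_two_thirds (ltW B0) kB0.
    apply: le_trans (powR_two_thirds A0 kA0) _.
    rewrite lerD2r ler_pM2l ?divr_gt0// lerD//.
    by rewrite lerXn2r// ?nnegrE//; lra.
  have wz c : 0 <= c <= z -> z <= 43 / 100 -> weight c <= weight z.
    move=> /andP[c0 cz] z43; apply: le_weight; rewrite ?c0//.
    have : z ^+ 2 <= (43 / 100) ^+ 2 by rewrite lerXn2r ?nnegrE//; lra.
    by clear; move: (z ^+ 2) => h; lra.
  have [zn|zn] := leP z (19 / 50).
    apply: (mid (19 / 50) (13 / 10) (3 / 4) (11 / 10)); try lra.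
    have := wz (17 / 50); rewrite /weight; lra.
  apply: (mid (43 / 100) (6 / 5) (4 / 5) (21 / 20)); try lra.
  have := wz (19 / 50); rewrite /weight; lra.
(* Here the lower bound l = z sqrt(2 - z^2) of [y] is beyond 1/sqrt 3, so [weight y <= weight l],
   and this [B] is exactly [weight l / weight z]. *)
exists (Num.sqrt (2 - z ^+ 2) * (1 - z ^+ 2)).
have z2 : z ^+ 2 <= 1 by rewrite expr_le1.
have B0 : 0 <= Num.sqrt (2 - z ^+ 2) * (1 - z ^+ 2).
  by rewrite mulr_ge0 ?sqrtr_ge0 ?subr_ge0.
set s := Num.sqrt _ in B0 *.
have s0 : 0 <= s by exact: sqrtr_ge0.
have s2 : s ^+ 2 = 2 - z ^+ 2 by rewrite sqr_sqrtr//; lra.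
split=> //.
  set l := z * s.
  have l2 : l ^+ 2 = z ^+ 2 * (2 - z ^+ 2) by rewrite exprMn s2.
  have l0 : 0 <= l by rewrite mulr_ge0.
  have ly : l <= y by rewrite -(@ler_pXn2r _ 2) ?nnegrE// l2.
  have l3 : 1 <= 3 * l ^+ 2.
    have z43 : (43 / 100) ^+ 2 <= z ^+ 2 by rewrite lerXn2r ?nnegrE ?(ltW zm)//; lra.
    (* 9/49 and 89/49 have sum 2 and product 801/2401 > 1/3, so this says z^2 (2 - z^2) >=
       801/2401. *)
    have : 0 <= (z ^+ 2 - 9 / 49) * (89 / 49 - z ^+ 2).
      by clear -z2 z43; move: (z ^+ 2) z2 z43 => t t1 t0; apply: mulr_ge0; lra.
    by rewrite l2; clear; lra.
  rewrite (_ : s * _ * _ = weight l); last first.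
    by rewrite /weight /l exprMn s2; ring.
  by apply: ge_weight; rewrite ?l0.
(* The tangent of the square root at m^2 makes the bound polynomial. *)
have sm m : 0 < m -> s <= (2 - z ^+ 2) / (2 * m) + m / 2.
  move=> m0; rewrite -s2 -subr_ge0.
  rewrite (_ : _ - _ = (s - m) ^+ 2 / (2 * m)); last by field; rewrite gt_eqF.
  by rewrite divr_ge0 ?sqr_ge0//; lra.
have tail kA kB m : 0 < kA -> 0 < kB -> 0 < m ->
   2 / 3 / kA * (z + z ^+ 3) + kA ^+ 2 / 3 +
   (2 / 3 / kB * (((2 - z ^+ 2) / (2 * m) + m / 2) * (1 - z ^+ 2)) + kB ^+ 2 / 3)
     <= 222 / 125 ->
   (z + z ^+ 3) `^ (2 / 3) + (s * (1 - z ^+ 2)) `^ (2 / 3) <= 222 / 125.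
  move=> kA0 kB0 m0; apply: le_trans; rewrite lerD ?powR_two_thirds//.
  apply: le_trans (powR_two_thirds B0 kB0) _.
  by rewrite lerD2r ler_pM2l ?divr_gt0// ler_wpM2r ?subr_ge0// sm.
have [zl|zl] := leP z (39 / 50).
  apply: (tail 1 (17 / 20) (13 / 10)); try lra.
  have [] := @bernstein4_ge0 z (43 / 100) (39 / 50); first by rewrite (ltW zm) zl.
  by clear; lra.
apply: (tail (23 / 20) (7 / 10) (11 / 10)); try lra.
have [] := @bernstein4_ge0 z (39 / 50) 1; first by rewrite (ltW zl) z1.
by clear; lra.
Qed.

Lemma powR2_inv_le n : (0 < n)%N -> 2 `^ n%:R^-1 <= 1 + n%:R^-1 :> R.
Proof.
move=> n0; have nn : n%:R != 0 :> R by rewrite pnatr_eq0 -lt0n.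
have b0 : 0 <= 1 + n%:R^-1 :> R by rewrite addr_ge0// invr_ge0.
rewrite -(@ler_pXn2r _ n) ?nnegrE ?powR_ge0//.
have -> : (2 `^ n%:R^-1) ^+ n = 2 :> R.
  by rewrite -powR_mulrn ?powR_ge0// -powRrM mulVf// powRr1.
case: n n0 nn b0 => // n _ nn _.
rewrite exprDn big_ord_recl big_ord_recl /= subn0 subn1 !expr1n expr0 !mul1r.
rewrite bin0 bin1 mulr1n expr1 -[_^-1 *+ _]mulr_natr mulVf// addrA lerDl sumr_ge0//.
Qed.

Lemma small_exponent : exists2 al : R, 0 < al <= 1 & 2 `^ al <= 513 / 512.
Proof.
exists 512%:R^-1; first by rewrite invr_gt0 ltr0n/= invf_le1 ?ler1n ?ltr0n.
by apply: le_trans (powR2_inv_le (n := 512) isT) _; lra.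
Qed.

Lemma weight01 z : 0 <= z <= 1 -> 0 <= weight z <= 1.
Proof.
move=> /andP[z0 z1]; have z2 : z ^+ 2 <= 1 by rewrite expr_le1.
have z20 := sqr_ge0 z.
rewrite mulr_ge0 ?subr_ge0//= -[leRHS]mulr1 ler_pM ?subr_ge0//.
by rewrite lerBlDr lerDl.
Qed.

(** The two factors of [weight y] are bounded separately, using 1 - z^2 (2 - z^2) = (1 - z^2)^2.
    This is cruder than [weight_transforms], but the factor stays at most 2 and vanishes at z = 1,
    which suits a tiny exponent. *)
Lemma weight_le_scaled z y : 0 <= z <= 1 -> 0 <= y -> y <= 2 * z - z ^+ 2 ->
    z ^+ 2 * (2 - z ^+ 2) <= y ^+ 2 ->
  weight y <= (2 - z) * (1 - z ^+ 2) * weight z.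
Proof.
move=> /andP[z0 z1] y0 yu yl.
have y1 : y <= 1.
  by apply: le_trans yu _; rewrite -subr_ge0 (_ : _ - _ = (1 - z) ^+ 2) ?sqr_ge0//; ring.
have y2 : y ^+ 2 <= 1 by rewrite expr_le1.
rewrite (_ : _ * weight z = (2 * z - z ^+ 2) * (1 - z ^+ 2) ^+ 2); last first.
  by rewrite /weight; ring.
rewrite ler_pM ?subr_ge0//.
by rewrite -subr_ge0 (_ : _ - _ = y ^+ 2 - z ^+ 2 * (2 - z ^+ 2)) ?subr_ge0//; ring.
Qed.

Lemma powR_le1 x p : 0 <= x <= 1 -> 0 <= p -> x `^ p <= 1.
Proof.
move=> /andP[x0 x1] p0; have -> : 1 = 1 `^ p :> R by rewrite powR1.
by apply: ge0_ler_powR; rewrite ?nnegrE.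
Qed.

(* Any factor below 2^(5/6) = 1.7818 serves; 513/512 * 16/9 = 57/32 = 1.78125. *)
Lemma potential_exists : exists (G : R -> R) (al K : R),
  [/\ 0 < al, 2 `^ al <= 513 / 512 & 0 < K] /\
  [/\ forall z, 0 <= z <= 1 -> 0 <= G z <= 2,
      forall z y, 0 <= z <= 1 -> 0 <= y -> y <= 2 * z - z ^+ 2 ->
        z ^+ 2 * (2 - z ^+ 2) <= y ^+ 2 ->
        G (z ^+ 2) + G y <= 16 / 9 * G z
    & forall t z, 0 <= t <= z -> z <= 1 -> t `^ al * (1 - z ^+ 2) <= K * G z].
Proof.
have [al /andP[al0 al1] al2] := small_exponent.
(* Within e of 0 or 1, one of the two transforms makes the weight so small that
   already its power [al] contracts; elsewhere that power is bounded by a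
   multiple of the 2/3-power, and [de] makes it negligible. *)
pose e := (3 / 4) `^ al^-1 / 4 : R.
have e4 : (4 * e) `^ al = 3 / 4.
  by rewrite /e mulrC divfK ?pnatr_eq0// -powRrM mulVf ?gt_eqF// powRr1//; lra.
have e0 : 0 < e by rewrite divr_gt0// powR_gt0//; lra.
pose c0 := (e * e) `^ (2 / 3).
have c00 : 0 < c0 by rewrite powR_gt0// mulr_gt0.
have e1 : 4 * e <= 1.
  rewrite leNgt; apply/negP => /ltW e1; have := ler_powR e1 (ltW al0).
  by rewrite powRr0 e4; lra.
have c01 : c0 <= 1.
  apply: powR_le1; last by lra.
  apply/andP; split; first by rewrite mulr_ge0// ltW.
  by rewrite -[leRHS]mulr1; apply: ler_pM; lra.
(* In the middle range [h z >= c0], and 16/9 - 222/125 = 2/1125 leaves room for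
   [de * (513 / 256)]. *)
pose de := c0 / 36 / 36.
have de0 : 0 < de by rewrite /de; clear -c00; lra.
have de1 : de <= 1 by rewrite /de; clear -c00 c01; lra.
pose h z := weight z `^ (2 / 3); pose k z := weight z `^ al.
have pw01 z p : 0 <= z <= 1 -> 0 <= p -> weight z `^ p <= 1.
  by move=> /weight01; exact: powR_le1.
exists (fun z => h z + de * k z), al, de^-1; split; first by rewrite invr_gt0.
split.
- move=> z z01; rewrite addr_ge0 ?mulr_ge0 ?powR_ge0 ?(ltW de0)//=.
  have : h z <= 1 by apply: pw01 => //; lra.
  have : de * k z <= 1 * 1.
    by apply: ler_pM; rewrite ?(ltW de0) ?powR_ge0 ?(pw01 _ _ z01 (ltW al0)).
  by clear; lra.
- move=> z y z01 y0 yu yl.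
  have /andP[w0 w1] := weight01 z01.
  have z2 : 0 <= z ^+ 2 <= 1.
    by case/andP: z01 => z0 z1; rewrite sqr_ge0 expr_le1.
  have y01 : 0 <= y <= 1.
    rewrite y0; apply: le_trans yu _.
    by rewrite -subr_ge0 (_ : _ - _ = (1 - z) ^+ 2) ?sqr_ge0//; ring.
  have wy0 : 0 <= weight y by case/andP: (weight01 y01).
  have A0 : 0 <= z + z ^+ 3 by case/andP: z01 => z0 _; rewrite addr_ge0 ?exprn_ge0.
  have wz2 : weight (z ^+ 2) = (z + z ^+ 3) * weight z by rewrite /weight; ring.
  have [B [B0 yB AB]] := weight_transforms z01 y0 yu yl.
  have le_pw p C : 0 <= p -> 0 <= C -> weight y <= C * weight z ->
      weight y `^ p <= C `^ p * weight z `^ p.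
    move=> p0 C0 yC; rewrite -powRM//.
    by apply: ge0_ler_powR; rewrite ?nnegrE//; exact: mulr_ge0.
  have hle : h (z ^+ 2) + h y <= 222 / 125 * h z.
    rewrite /h wz2 powRM// -/(h z).
    apply: le_trans (lerD (lexx _) (le_pw _ _ _ B0 yB)) _; first by lra.
    by rewrite -mulrDl ler_wpM2r ?powR_ge0.
  pose C := (2 - z) * (1 - z ^+ 2).
  have C0 : 0 <= C.
    case/andP: z01 => z0 z1; case/andP: z2 => _ z2.
    by rewrite mulr_ge0 ?subr_ge0// (le_trans z1)// ler1n.
  have kle : k (z ^+ 2) + k y <= ((z + z ^+ 3) `^ al + C `^ al) * k z.
    rewrite /k wz2 powRM// -/(k z).
    apply: le_trans (lerD (lexx _) (le_pw _ _ (ltW al0) C0 _)) _.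
      exact: weight_le_scaled.
    by rewrite -mulrDl.
  have pw2 x : 0 <= x <= 2 -> x `^ al <= 513 / 512.
    move=> /andP[x0 x2]; apply: le_trans al2.
    by apply: ge0_ler_powR; rewrite ?nnegrE// ltW.
  have pwe x : 0 <= x <= 4 * e -> x `^ al <= 3 / 4.
    move=> /andP[x0 x2]; rewrite -e4.
    by apply: ge0_ler_powR; rewrite ?nnegrE ?mulr_ge0// ltW.
  have h0 : 0 <= h z by exact: powR_ge0.
  have k0 : 0 <= k z by exact: powR_ge0.
  have A2 : z + z ^+ 3 <= 2 * z.
    case/andP: z01 => z0 z1; case/andP: z2 => _ z2.
    have : z * z ^+ 2 <= z * 1 by rewrite ler_wpM2l.
    by rewrite -exprS mulr1; clear; move: (z ^+ 3) => u; lra.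
  have C2 : C <= 4 * (1 - z).
    case/andP: z01 => z0 z1.
    have : 0 <= (1 - z) * (2 - z + z ^+ 2).
      clear -z0 z1; apply: mulr_ge0; first by rewrite subr_ge0.
      by apply: addr_ge0; [lra|exact: sqr_ge0].
    by rewrite /C; clear; lra.
  have C3 : C <= 2.
    case/andP: z01 => z0 z1; case/andP: z2 => z20 z2.
    by rewrite /C -[leRHS]mulr1 ler_pM ?subr_ge0 ?gerBl ?lerBlDr ?lerDl// (le_trans z1)// ler1n.
  rewrite addrACA -mulrDr [leRHS]mulrDr.
  suff main : 222 / 125 * h z + de * (((z + z ^+ 3) `^ al + C `^ al) * k z) <=
      16 / 9 * h z + 16 / 9 * (de * k z).
    by apply: le_trans main; rewrite lerD// ler_pM2l.
  have hmono : 222 / 125 * h z <= 16 / 9 * h z by clear -h0; lra.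
  have ends : (z + z ^+ 3) `^ al + C `^ al <= 16 / 9 ->
      222 / 125 * h z + de * (((z + z ^+ 3) `^ al + C `^ al) * k z) <=
      16 / 9 * h z + 16 / 9 * (de * k z).
    move=> le; rewrite lerD// [leRHS]mulrCA ler_pM2l// ler_wpM2r//.
  case/andP: (z01) => z0 z1.
  have bnd : 3 / 4 + 513 / 512 <= 16 / 9 :> R by clear; lra.
  have A4 : 0 <= z + z ^+ 3 <= 2 by rewrite A0 (le_trans A2)//; clear -z1; lra.
  have [zs|zs] := leP z e.
    apply: ends; apply: (le_trans _ bnd); apply: lerD; last by rewrite pw2// C0 C3.
    by rewrite pwe// A0 (le_trans A2)//; clear -zs z0 e0; lra.
  have [zl|zl] := leP (1 - e) z.
    apply: ends; apply: (le_trans _ bnd); rewrite addrC.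
    apply: lerD; last by rewrite pw2.
    by rewrite pwe// C0 (le_trans C2)//; clear -zl; lra.
  have ch : c0 <= h z.
    rewrite /c0 /h; apply: ge0_ler_powR;
      [by clear; lra|by rewrite nnegrE mulr_ge0 ?(ltW e0)|by rewrite nnegrE|].
    apply: ler_pM; [exact: ltW|exact: ltW|exact: ltW|].
    have : z ^+ 2 <= z by rewrite expr2 -[leRHS]mulr1 ler_wpM2l.
    by clear -zl; move: (z ^+ 2) => u; lra.
  have k1 : k z <= 1 by rewrite pw01// ltW.
  have S2 : (z + z ^+ 3) `^ al + C `^ al <= 513 / 512 + 513 / 512.
    by apply: lerD; apply: pw2; rewrite ?C0.
  have : de * (((z + z ^+ 3) `^ al + C `^ al) * k z) <= de * ((513 / 512 + 513 / 512) * 1).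
    rewrite ler_pM2l//; apply: ler_pM => //.
    by rewrite addr_ge0 ?powR_ge0.
  have : 0 <= de * k z by rewrite mulr_ge0// ltW.
  move: (de * (_ * k z)) (de * k z) => u v; rewrite /de; move: ch c00; clear.
  lra.
- move=> t z /andP[t0 tz] z1.
  have z0 := le_trans t0 tz.
  have z2 : z ^+ 2 <= 1 by rewrite expr_le1.
  have z20 := sqr_ge0 z.
  rewrite -ler_pdivrMl ?invr_gt0// invrK.
  (* The tiny-exponent term suffices: [al <= 1] gives 1 - z^2 <= (1 - z^2)^al. *)
  apply: (@le_trans _ _ (de * k z)); last by rewrite lerDr powR_ge0.
  rewrite ler_pM2l// /k /weight powRM ?subr_ge0//.
  apply: ler_pM; rewrite ?powR_ge0 ?subr_ge0//.
    by apply: ge0_ler_powR; rewrite ?nnegrE// ltW.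
  have [->|z2n] := eqVneq (1 - z ^+ 2) 0; first exact: powR_ge0.
  by apply: ger1_powR => //; rewrite lt0r z2n subr_ge0 z2 lerBlDr lerDl.
Qed.

End Potential.

(** * Counting good synthetic channels *)

Section Polarization.
Variable R : realType.
Implicit Types (W : channel R) (n i : nat).

Lemma bits_cons n i : bits n.+1 i = odd (i %/ 2 ^ n) :: bits n i.
Proof.
rewrite /bits /= subSS subn0; congr cons.
by rewrite (iotaDl 1 1 n) -map_comp; apply: eq_map => j /=; rewrite add1n subSS.
Qed.

Lemma bits_addn n i : bits n (2 ^ n + i) = bits n i.
Proof.
apply/eq_in_map => j; rewrite mem_iota => /andP[j1 jn].
have -> : (2 ^ n = 2 ^ j * 2 ^ (n - j))%N by rewrite -expnD subnKC// -ltnS -add1n.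
by rewrite divnMDl ?expn_gt0// oddD oddX -[j]prednK//= orbF.
Qed.

(** Peels off the transform applied to [W] itself, so inductions on [n] let the channel vary. *)
Lemma polar_channelS W n i :
  polar_channel W n.+1 i = polar_channel (transform W (odd (i %/ 2 ^ n))) n i.
Proof. by rewrite /polar_channel bits_cons. Qed.

Lemma polar_channelS0 W n i : (i < 2 ^ n)%N ->
  polar_channel W n.+1 i = polar_channel (transform0 W) n i.
Proof. by move=> ilt; rewrite polar_channelS divn_small. Qed.

Lemma polar_channelS1 W n i : (i < 2 ^ n)%N ->
  polar_channel W n.+1 (2 ^ n + i) = polar_channel (transform1 W) n i.
Proof.
move=> ilt; rewrite polar_channelS divnDl ?dvdnn// divnn expn_gt0/= divn_small//.
by rewrite /polar_channel bits_addn.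
Qed.

Lemma stochastic_polar W n i : stochastic W -> stochastic (polar_channel W n i).
Proof.
elim: n W => [|n IH] W kW; first by [].
by rewrite polar_channelS; apply/IH/stochastic_transform.
Qed.

Lemma sum_polarS W n (f : channel R -> R) :
  \sum_(i < 2 ^ n.+1) f (polar_channel W n.+1 i) =
  \sum_(i < 2 ^ n) f (polar_channel (transform0 W) n i) +
  \sum_(i < 2 ^ n) f (polar_channel (transform1 W) n i).
Proof.
have -> : (2 ^ n.+1 = 2 ^ n + 2 ^ n)%N by rewrite expnS mul2n addnn.
rewrite big_split_ord/=; congr (_ + _); apply: eq_bigr => i _.
  by rewrite polar_channelS0.
by rewrite polar_channelS1.
Qed.

Lemma sum_polar_capacity W n : stochastic W ->
  \sum_(i < 2 ^ n) sym_capacity (polar_channel W n i) = (2 ^ n)%:R * sym_capacity W.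
Proof.
elim: n W => [|n IH] W kW; first by rewrite expn0 big_ord1 mul1r.
rewrite sum_polarS !IH; [|exact: (stochastic_transform true)|exact: (stochastic_transform false)].
by rewrite -mulrDr sym_capacity_transform// expnS natrM mulrCA mulrA.
Qed.

Lemma sum_polar_potential (G : R -> R) (la : R) W n : 0 <= la ->
  (forall z y, 0 <= z <= 1 -> 0 <= y -> y <= 2 * z - z ^+ 2 ->
    z ^+ 2 * (2 - z ^+ 2) <= y ^+ 2 -> G (z ^+ 2) + G y <= la * G z) ->
  stochastic W ->
  \sum_(i < 2 ^ n) G (bhat (polar_channel W n i)) <= la ^+ n * G (bhat W).
Proof.
move=> la0 GP; elim: n W => [|n IH] W kW; first by rewrite expn0 big_ord1 expr0 mul1r.
rewrite (sum_polarS W n (fun V => G (bhat V))).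
have k0 := stochastic_transform false kW; have k1 := stochastic_transform true kW.
apply: le_trans (lerD (IH _ k0) (IH _ k1)) _.
rewrite -mulrDr exprSr -mulrA ler_wpM2l ?exprn_ge0//.
rewrite addrC /transform bhat_transform1//.
apply: GP; rewrite ?bhat_ge0 ?bhat_transform0_le ?bhat_transform0_ge//=.
by have [_] := has_csum_bhat kW.
Qed.

Lemma good_indices (Pe : R) : 0 < Pe -> exists2 c : R, 0 < c &
  forall W n (r : R), bms W -> r <= capacity W - c * (57 / 64) ^+ n ->
  (2 ^ n)%:R * r <=
    #|[set i : 'I_(2 ^ n) | error_prob (polar_channel W n i) <= Pe / (2 ^ n)%:R]|%:R.
Proof.
move=> Pe0; have [G [al [K [[al0 al2 K0] [G01 Gstep Gge]]]]] := potential_exists R.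
have l2 := ln2_gt0 R.
have Pal : 0 < Pe `^ al by exact: powR_gt0.
(* The 2 bounds [G] at the root; the rest is the cost K / (ln 2 * t^al) of a bad index at t = Pe /
   N, without its factor N^al. *)
exists (2 * K / (ln 2 * Pe `^ al)); first by rewrite divr_gt0 ?mulr_gt0.
move=> W n r bW rle; have kW := bms_stochastic bW.
set N : R := (2 ^ n)%:R; have N0 : 0 < N by rewrite ltr0n expn_gt0.
set t := Pe / N; have t0 : 0 < t by rewrite divr_gt0.
set c := 2 * K / _ in rle.
have tal : 0 < t `^ al by exact: powR_gt0.
have cap := sum_polar_capacity n kW; rewrite -sym_capacityE// -/N in cap.
set A := [set i | _].
(* An index in [A] carries at most capacity 1; outside [A], Z is at least the error probability,
   hence at least [t], and the potential dominates the capacity. *)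
have term (i : 'I_(2 ^ n)) : sym_capacity (polar_channel W n i) <=
    (i \in A)%:R + K / (ln 2 * t `^ al) * G (bhat (polar_channel W n i)).
  have kV := stochastic_polar n i kW; have [_ Z1] := has_csum_bhat kV; have Z0 := bhat_ge0 kV.
  have KG : 0 <= K / (ln 2 * t `^ al) by rewrite divr_ge0 ?mulr_ge0 ?ltW.
  have /andP[Gi0 _] := G01 (bhat (polar_channel W n i)) (introT andP (conj Z0 Z1)).
  have [iA|iA] := boolP (i \in A).
    by apply: le_trans (sym_capacity_le1 kV) _; rewrite lerDl mulr_ge0.
  rewrite add0r; apply: le_trans (sym_capacity_le kV) _.
  have tZ : 0 <= t <= bhat (polar_channel W n i).
    rewrite ltW//=; apply: le_trans (error_prob_le_bhat kV).
    by move: iA; rewrite inE -ltNge => /ltW.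
  have := Gge _ _ tZ Z1.
  rewrite -ler_pdivlMl// => h; rewrite ler_pdivrMr//; apply: le_trans h _.
  rewrite le_eqVlt; apply/orP; left; apply/eqP; field.
  by rewrite !gt_eqF.
have := ler_sum (index_enum 'I_(2 ^ n)) (P := predT) (fun (i : 'I_(2 ^ n)) _ => term i).
rewrite cap big_split/= -mulr_sumr => h1.
have h2 : \sum_(i < 2 ^ n) (i \in A)%:R = #|A|%:R :> R.
  by rewrite -natr_sum -sum1_card [in RHS]big_mkcond.
rewrite h2 in h1.
have la0 : 0 <= 16 / 9 :> R by rewrite divr_ge0.
have h3 := sum_polar_potential n la0 Gstep kW.
have h4 : \sum_(i < 2 ^ n) G (bhat (polar_channel W n i)) <= (16 / 9) ^+ n * 2.
  apply: le_trans h3 _; rewrite ler_wpM2l ?exprn_ge0//.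
  have [_ Z1] := has_csum_bhat kW; have Z0 := bhat_ge0 kW.
  by have /andP[] := G01 (bhat W) (introT andP (conj Z0 Z1)).
have KG : 0 <= K / (ln 2 * t `^ al) by rewrite divr_ge0 ?mulr_ge0 ?ltW.
have h5 : K / (ln 2 * t `^ al) * ((16 / 9) ^+ n * 2) <= N * (c * (57 / 64) ^+ n).
  have Nal : N `^ al = (2 `^ al) ^+ n.
    by rewrite /N natrX -(powR_mulrn n (ler0n R 2)) -(powR_mulrn n (powR_ge0 2 al)) -!powRrM mulrC.
  have tE : t `^ al * N `^ al = Pe `^ al by rewrite -powRM ?ltW// divfK ?gt_eqF.
  have Nal0 : 0 < N `^ al by exact: powR_gt0.
  have -> : K / (ln 2 * t `^ al) * ((16 / 9) ^+ n * 2) = c * (N `^ al * (16 / 9) ^+ n).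
    rewrite /c -tE; field.
    by rewrite !gt_eqF.
  rewrite [leRHS]mulrCA ler_pM2l; last by rewrite divr_gt0 ?mulr_gt0.
  rewrite Nal /N natrX -!exprMn lerXn2r ?nnegrE ?mulr_ge0 ?powR_ge0//.
  apply: le_trans (ler_wpM2r la0 al2) _.
  by clear; lra.
have h6 := le_trans h1 (lerD (lexx _) (le_trans (ler_wpM2l KG h4) h5)).
have h7 : N * r <= N * (capacity W - c * (57 / 64) ^+ n) by rewrite ler_pM2l.
apply: le_trans h7 _; rewrite mulrBr lerBlDr.
exact: h6.
Qed.

(** N is the largest power of two below B = beta / d^6, so 2N >= B and c^6 (57/64)^(6n) <= c^6 / N
    <= d^6. The summand 1 in [beta] makes B >= 1, so that such a power exists. *)
Lemma blocklength_exists (c : R) : 0 < c -> exists2 beta : R, 0 < beta &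
  forall d : R, 0 < d <= 1 ->
  exists n, (2 ^ n)%:R <= beta / d ^+ 6 /\ c * (57 / 64) ^+ n <= d.
Proof.
move=> c0; exists (2 * c ^+ 6 + 1); first by rewrite addr_gt0// mulr_gt0// exprn_gt0.
move=> d /andP[d0 d1]; set B := _ / d ^+ 6.
have d60 : 0 < d ^+ 6 by rewrite exprn_gt0.
have B1 : 1 <= B.
  rewrite ler_pdivlMr// mul1r; apply: (@le_trans _ _ 1).
    by rewrite exprn_ile1// ltW.
  by rewrite lerDr mulr_ge0// exprn_ge0// ltW.
pose m := Num.truncn B.
have m0 : (0 < m)%N by rewrite truncn_gt0.
exists (trunc_log 2 m).
have /andP[le lt] := @trunc_log_bounds 2 m isT m0.
have /andP[tl tu] := truncn_itv (le_trans ler01 B1); rewrite -/m in tl tu.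
split; first by apply: le_trans tl; rewrite ler_nat.
set n := trunc_log 2 m in le lt *.
have Bn : B <= 2 * (2 ^ n)%:R.
  by apply: le_trans (ltW tu) _; rewrite -natrM ler_nat -expnS.
rewrite -(@ler_pXn2r _ 6) ?nnegrE ?(ltW d0)//; last first.
  by rewrite mulr_ge0 ?exprn_ge0 ?divr_ge0// ltW.
rewrite exprMn exprAC.
have q : (57 / 64) ^+ 6 <= 2^-1 :> R by lra.
have q0 : 0 <= (57 / 64) ^+ 6 :> R by rewrite exprn_ge0// divr_ge0.
have hn : ((57 / 64) ^+ 6) ^+ n <= 2^-1 ^+ n :> R by rewrite lerXn2r ?nnegrE ?invr_ge0.
have c60 : 0 < c ^+ 6 by rewrite exprn_gt0.
apply: le_trans (ler_wpM2l (ltW c60) hn) _.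
have P0 : 0 < (2 ^ n)%:R :> R by rewrite ltr0n expn_gt0.
rewrite exprVn -natrX ler_pdivrMr//.
move: Bn; rewrite /B ler_pdivrMr//.
by move: (d ^+ 6) (c ^+ 6) ((2 ^ n)%:R) => x y z; clear; lra.
Qed.

End Polarization.

(** * The synthetic channels are the bit channels *)

Section Halves.
Variable n : nat.

Lemma expn2S : (2 ^ n + 2 ^ n)%N = (2 ^ n.+1)%N.
Proof. by rewrite expnS mul2n addnn. Qed.

Definition lo (j : 'I_(2 ^ n)) : 'I_(2 ^ n.+1) := cast_ord expn2S (lshift _ j).
Definition hi (j : 'I_(2 ^ n)) : 'I_(2 ^ n.+1) := cast_ord expn2S (rshift _ j).

Variant half_spec : 'I_(2 ^ n.+1) -> Type :=
| HalfLo j : half_spec (lo j)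
| HalfHi j : half_spec (hi j).

Lemma halfP i : half_spec i.
Proof.
rewrite -[i](cast_ordKV expn2S); case: (split_ordP (cast_ord (esym expn2S) i)) => j ->.
  exact: HalfLo.
exact: HalfHi.
Qed.

Definition merge_halves (T : Type) (f g : 'I_(2 ^ n) -> T) (i : 'I_(2 ^ n.+1)) : T :=
  match fintype.split (cast_ord (esym expn2S) i) with inl j => f j | inr j => g j end.

Lemma merge_lo T (f g : 'I_(2 ^ n) -> T) j : merge_halves f g (lo j) = f j.
Proof. by rewrite /merge_halves /lo cast_ordK (unsplitK (inl j)). Qed.

Lemma merge_hi T (f g : 'I_(2 ^ n) -> T) j : merge_halves f g (hi j) = g j.
Proof. by rewrite /merge_halves /hi cast_ordK (unsplitK (inr j)). Qed.

Lemma big_halves (T : Type) (idx : T) (op : Monoid.com_law idx) (F : 'I_(2 ^ n.+1) -> T) :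
  \big[op/idx]_i F i = op (\big[op/idx]_j F (lo j)) (\big[op/idx]_j F (hi j)).
Proof.
rewrite (reindex (cast_ord expn2S)) ?big_split_ord//=.
by apply: onW_bij; exists (cast_ord (esym expn2S)); [exact: cast_ordK|exact: cast_ordKV].
Qed.

Lemma polar_matrixS j k :
  [/\ polar_matrix n.+1 (lo j) (lo k) = polar_matrix n j k,
      polar_matrix n.+1 (lo j) (hi k) = 0,
      polar_matrix n.+1 (hi j) (lo k) = polar_matrix n j k
    & polar_matrix n.+1 (hi j) (hi k) = polar_matrix n j k].
Proof.
(* [ntensmxSS] unfolds powers from exponent 2 on, hence the separate case n = 0. *)
rewrite /polar_matrix; move: j k; rewrite /lo /hi; move: expn2S; case: n => [|m] e j k.
  by split; rewrite !mxE (ord1 j) (ord1 k).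
rewrite ntensmxSS.
have E (i : 'I_(2 ^ m.+1)) :
    (mxtens_unindex (cast_ord e (lshift _ i) : 'I_(2 * 2 ^ m.+1)) = (ord0, i)) *
    (mxtens_unindex (cast_ord e (rshift _ i) : 'I_(2 * 2 ^ m.+1)) = (ord_max, i)).
  have N0 : (0 < 2 ^ m.+1)%N by rewrite expn_gt0.
  split; congr pair; apply: val_inj => /=.
  - by rewrite divn_small.
  - by rewrite modn_small.
  - by rewrite divnDl ?dvdnn// divnn N0 divn_small.
  - by rewrite modnDl modn_small.
by split; rewrite mxE !E /= mxE /= ?mul1r ?mul0r.
Qed.

End Halves.

Section HalfRows.
Variable n : nat.
Implicit Type u : 'rV['F_2]_(2 ^ n.+1).

Definition rlo u : 'rV['F_2]_(2 ^ n) := \row_j u 0 (lo j).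
Definition rhi u : 'rV['F_2]_(2 ^ n) := \row_j u 0 (hi j).
Definition rmerge (u v : 'rV['F_2]_(2 ^ n)) : 'rV['F_2]_(2 ^ n.+1) :=
  \row_i merge_halves (u 0) (v 0) i.

Lemma rlo_merge (u v : 'rV['F_2]_(2 ^ n)) : rlo (rmerge u v) = u.
Proof. by apply/rowP => j; rewrite !mxE merge_lo. Qed.

Lemma rhi_merge (u v : 'rV['F_2]_(2 ^ n)) : rhi (rmerge u v) = v.
Proof. by apply/rowP => j; rewrite !mxE merge_hi. Qed.

Lemma rmergeK u : rmerge (rlo u) (rhi u) = u.
Proof. by apply/rowP => i; case: (halfP i) => j; rewrite mxE ?merge_lo ?merge_hi mxE. Qed.

Lemma sum_rows (V : nmodType) (P : pred 'rV['F_2]_(2 ^ n.+1)) (F : 'rV['F_2]_(2 ^ n.+1) -> V) :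
  \sum_(u | P u) F u = \sum_u \sum_(v | P (rmerge u v)) F (rmerge u v).
Proof.
rewrite (reindex (fun p => rmerge p.1 p.2)); last first.
  apply: onW_bij; exists (fun u => (rlo u, rhi u)) => [[u v]|u] /=.
    by rewrite rlo_merge rhi_merge.
  by rewrite rmergeK.
by rewrite pair_big_dep.
Qed.

Lemma encode_merge (u v : 'rV['F_2]_(2 ^ n)) :
  encode (rmerge u v) = rmerge (encode u + encode v) (encode v).
Proof.
apply/rowP => i; rewrite !mxE.
rewrite big_halves /=; case: (halfP i) => k; rewrite ?merge_lo ?merge_hi ?mxE.
  congr (_ + _); apply: eq_bigr => j _; rewrite !mxE ?merge_lo ?merge_hi.
    by have [-> _ _ _] := polar_matrixS j k.
  by have [_ _ -> _] := polar_matrixS j k.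
rewrite big1 ?add0r => [|j _]; last first.
  by have [_ -> _ _] := polar_matrixS j k; rewrite mulr0.
apply: eq_bigr => j _; rewrite !mxE ?merge_hi.
by have [_ _ _ ->] := polar_matrixS j k.
Qed.

End HalfRows.

Lemma encode0E (u : 'rV['F_2]_(2 ^ 0)) : encode u = u.
Proof. by rewrite /encode /polar_matrix ntensmx0 mulmx1. Qed.

Lemma encodeD n (u v : 'rV['F_2]_(2 ^ n)) : encode (u + v) = encode u + encode v.
Proof. exact: mulmxDl. Qed.

Lemma rowF2_addK n (u v : 'rV['F_2]_n) : u + v + v = u.
Proof.
by apply/rowP => j; rewrite !mxE -addrA; case: (F2_cases (v 0 j)) => ->; rewrite ?F2_11 !addr0.
Qed.

(** Allows sums over message halves to be reindexed by codeword halves. *)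
Lemma encodeK n : involutive (@encode n).
Proof.
elim: n => [u|n IH u]; first by rewrite !encode0E.
by rewrite -(rmergeK u) !encode_merge encodeD !IH rowF2_addK.
Qed.

Lemma prod_sum_F2 (R : comNzRingType) N (F : 'I_N -> 'F_2 -> R) :
  \prod_k \sum_x F k x = \sum_(x : 'rV['F_2]_N) \prod_k F k (x 0 k).
Proof.
rewrite bigA_distr_bigA /= (reindex (fun x : 'rV['F_2]_N => [ffun k => x 0 k])) /=.
  by apply: eq_bigr => x _; apply: eq_bigr => k _; rewrite ffunE.
apply: onW_bij; exists (fun f : {ffun 'I_N -> 'F_2} => \row_k f k) => [x|f].
  by apply/rowP => k; rewrite mxE ffunE.
by apply/ffunP => k; rewrite ffunE mxE.
Qed.

Section Likelihood.
Variables (R : realType) (W : channel R) (n : nat).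
Implicit Types (y : {ffun 'I_(2 ^ n.+1) -> out W}) (p : 'rV['F_2]_(2 ^ n.+1)).

Definition halves0 y : {ffun 'I_(2 ^ n) -> out (transform0 W)} :=
  [ffun k => (y (lo k), y (hi k))].

Definition halves1 y (x : 'rV['F_2]_(2 ^ n)) : {ffun 'I_(2 ^ n) -> out (transform1 W)} :=
  [ffun k => (y (lo k), y (hi k), x 0 k)].

Lemma block_trans_merge (u v : 'rV['F_2]_(2 ^ n)) y :
  block_trans (rmerge u v) y = \prod_k (W (u 0 k) (y (lo k)) * W (v 0 k) (y (hi k))).
Proof.
rewrite /block_trans big_halves -big_split/=.
by apply: eq_bigr => k _; rewrite !mxE merge_lo merge_hi.
Qed.

Lemma expr_half : 2 ^- (2 ^ n.+1 - 1) = 2 ^- (2 ^ n - 1) * 2 ^- (2 ^ n) :> R.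
Proof.
by rewrite -invfM -exprD; congr (_ ^-1); congr (_ ^+ _);
  rewrite -expn2S addnBAC ?expn_gt0.
Qed.

(** The upper half of the message is free; summed over its codewords, the product over positions
    factors into the sums over [x2] of [transform0]. *)
Lemma bit_likelihood_lo (i : 'I_(2 ^ n)) y p v :
  bit_likelihood (lo i) y p v = bit_likelihood (W := transform0 W) i (halves0 y) (rlo p) v.
Proof.
rewrite /bit_likelihood expr_half -mulrA; congr (_ * _).
rewrite sum_rows mulr_sumr [RHS]big_mkcond; apply: eq_bigr => u _.
have cond v' : (rmerge u v' 0 (lo i) == v) &&
    [forall j : 'I_(2 ^ n.+1), (j < lo i)%N ==> (rmerge u v' 0 j == p 0 j)] =
    (u 0 i == v) && [forall j : 'I_(2 ^ n), (j < i)%N ==> (u 0 j == rlo p 0 j)].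
  rewrite mxE merge_lo; congr (_ && _); apply/forallP/forallP => h j.
    by have := h (lo j); rewrite !mxE merge_lo.
  case: (halfP j) => k; first by have := h k; rewrite !mxE merge_lo.
  by apply/implyP => /=; rewrite ltnNge (leq_trans (ltnW (ltn_ord i))) ?leq_addr.
rewrite (eq_bigl _ _ cond); case: ifP => _; last by rewrite big_pred0_eq mulr0.
have -> : block_trans (W := transform0 W) (encode u) (halves0 y) =
    \prod_k \sum_x 2^-1 * W (encode u 0 k + x) (y (lo k)) * W x (y (hi k)).
  by apply: eq_bigr => k _; rewrite ffunE.
rewrite prod_sum_F2.
rewrite (reindex_inj (can_inj (@encodeK n))) mulr_sumr; apply: eq_bigr => v' _.
rewrite encode_merge block_trans_merge encodeK.
have -> : 2 ^- (2 ^ n) = \prod_(k < 2 ^ n) 2^-1 :> R.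
  by rewrite prodr_const card_ord exprVn.
by rewrite -big_split/=; apply: eq_bigr => k _; rewrite mxE mulrA.
Qed.

(** The lower half of the message is already fixed to [rlo p]; its codeword supplies the third
    output component of [transform1]. *)
Lemma bit_likelihood_hi (i : 'I_(2 ^ n)) y p v :
  bit_likelihood (hi i) y p v =
  bit_likelihood (W := transform1 W) i (halves1 y (encode (rlo p))) (rhi p) v.
Proof.
rewrite /bit_likelihood expr_half -mulrA; congr (_ * _).
rewrite sum_rows (bigD1 (rlo p))//= [X in _ * (_ + X)]big1 ?addr0; last first.
  move=> u up; apply: big_pred0 => v'; apply/negP => /andP[_ /forallP h].
  move/eqP: up; apply; apply/rowP => j; have := h (lo j).
  by rewrite !mxE merge_lo /= (leq_trans (ltn_ord j)) ?leq_addr//= => /eqP.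
rewrite mulr_sumr; apply: eq_big => [v'|v' _].
  rewrite mxE merge_hi; congr (_ && _); apply/forallP/forallP => h j.
    by have := h (hi j); rewrite !mxE merge_hi /= ltn_add2l.
  case: (halfP j) => k; first by rewrite !mxE merge_lo mxE eqxx implybT.
  by have := h k; rewrite !mxE merge_hi /= ltn_add2l.
rewrite encode_merge block_trans_merge /block_trans.
have -> : 2 ^- (2 ^ n) = \prod_(k < 2 ^ n) 2^-1 :> R.
  by rewrite prodr_const card_ord exprVn.
by rewrite -big_split/=; apply: eq_bigr => k _; rewrite ffunE mxE /= mulrA.
Qed.

End Likelihood.

Section ProductSums.
Variable R : realType.

Lemma has_csum_prod (T : countType) m (F : 'I_m -> T -> R) (s : 'I_m -> R) :
  (forall k, has_csum (F k) (s k)) ->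
  has_csum (fun y : {ffun 'I_m -> T} => \prod_k F k (y k)) (\prod_k s k).
Proof.
elim: m F s => [|m IH] F s Fs.
  pose e (x : unit) : {ffun 'I_0 -> T} :=
    [ffun k : 'I_0 => match k with Ordinal _ h => False_rect T (notF h) end].
  have be : bijective e by exists (fun=> tt) => [[]|f] //; apply/ffunP => -[].
  apply/(has_csum_bij _ _ be); rewrite big_ord0.
  have E : \sum_(x : unit) 1 = 1 :> R by rewrite big_const card_unit /= addr0.
  rewrite -[X in has_csum _ X]E.
  apply: eq_has_csum (has_csum_fin (I := unit) (fun=> @ler01 R)) => x.
  by rewrite big_ord0.
pose e (q : T * {ffun 'I_m -> T}) : {ffun 'I_m.+1 -> T} :=
  [ffun i => if unlift ord0 i is Some j then q.2 j else q.1].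
have be : bijective e.
  exists (fun g : {ffun 'I_m.+1 -> T} => (g ord0, [ffun j => g (lift ord0 j)])) => [[x f]|g].
    rewrite /e ffunE unlift_none; congr pair; apply/ffunP => j.
    by rewrite !ffunE liftK.
  by apply/ffunP => i; rewrite ffunE; case: unliftP => [j|] ->; rewrite ?ffunE.
apply/(has_csum_bij _ _ be); rewrite big_ord_recl.
apply: eq_has_csum (has_csum_mul (Fs ord0) (IH _ _ (fun k => Fs (lift ord0 k)))) => -[x f].
rewrite big_ord_recl /= ffunE unlift_none; congr (_ * _).
by apply: eq_bigr => k _; rewrite ffunE liftK.
Qed.

(* [b] is the likelihood of the correct value, [a] that of the other one. *)
Definition tie_loss (a b : R) : R := (b < a)%R%:R + 2^-1 * (a == b)%R%:R.

Lemma tie_loss_itv a b : 0 <= tie_loss a b <= 1.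
Proof.
rewrite /tie_loss; case: (ltgtP a b) => _ /=; rewrite ?mulr0 ?addr0 ?add0r ?mulr1 ?lexx ?ler01//.
by rewrite invr_ge0 ler0n invf_le1 ?ler1n.
Qed.

Lemma error_probE (W : channel R) :
  error_prob W = csum (fun y => W 1 y * tie_loss (W 0 y) (W 1 y)).
Proof. by []. Qed.

Variable n : nat.

Lemma has_csum_block_trans (W : channel R) (x : 'rV['F_2]_(2 ^ n)) : stochastic W ->
  has_csum (block_trans (W := W) x) 1.
Proof.
move=> [_ W1]; have := has_csum_prod (fun k => W1 (x 0 k)).
by rewrite prodr_const expr1n.
Qed.

Lemma block_trans_ge0 (W : channel R) (x : 'rV['F_2]_(2 ^ n)) y : stochastic W ->
  0 <= block_trans (W := W) x y.
Proof. by case=> W0 _; apply: prodr_ge0. Qed.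

Lemma has_csum_bit_loss (W : channel R) i p : stochastic W ->
  exists s, has_csum (fun y => bit_likelihood (n := n) (W := W) i y p 1 *
    tie_loss (bit_likelihood i y p 0) (bit_likelihood i y p 1)) s.
Proof.
move=> kW.
have c0 : 0 <= 2 ^- (2 ^ n - 1) :> R by rewrite invr_ge0 exprn_ge0.
have L := has_csumZ c0 (has_csum_sum (index_enum 'rV['F_2]_(2 ^ n))
  (fun u => (u 0 i == 1) && [forall j : 'I_(2 ^ n), (j < i)%N ==> (u 0 j == p 0 j)])
  (fun u => has_csum_block_trans (encode u) kW)).
have B y : 0 <= bit_likelihood (W := W) i y p 1 *
    tie_loss (bit_likelihood i y p 0) (bit_likelihood i y p 1) <= bit_likelihood i y p 1.
  have /andP[t0 t1] := tie_loss_itv (bit_likelihood i y p 0) (bit_likelihood i y p 1).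
  have L0 : 0 <= bit_likelihood i y p 1.
    by rewrite mulr_ge0// sumr_ge0// => u _; exact: block_trans_ge0.
  by rewrite mulr_ge0//= -[leRHS]mulr1 ler_wpM2l.
by have [s hs _] := has_csum_dominated B L; exists s.
Qed.

End ProductSums.

(** * Averaged error of one bit decision *)

Section BitError.
Variable R : realType.

(* [p] ranges over whole rows although only its first [i] entries matter; the
   factor [2 ^- (2 ^ n - i)] averages over the other ones. *)
Definition bit_error (W : channel R) n (i : 'I_(2 ^ n)) : R :=
  \sum_(p : 'rV['F_2]_(2 ^ n)) 2 ^- (2 ^ n - i) *
    csum (fun y => bit_likelihood (W := W) i y p 1 *
      tie_loss (bit_likelihood i y p 0) (bit_likelihood i y p 1)).

Lemma bit_error_lo (W : channel R) n (i : 'I_(2 ^ n)) :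
  bit_error W (lo i) = bit_error (transform0 W) i.
Proof.
have be : bijective (@halves0 R W n).
  exists (fun z : {ffun 'I_(2 ^ n) -> out (transform0 W)} =>
    [ffun k => merge_halves (fun j => (z j).1) (fun j => (z j).2) k]) => [y|z].
    by apply/ffunP => k; rewrite ffunE; case: (halfP k) => j; rewrite ?merge_lo ?merge_hi ffunE.
  by apply/ffunP => k; rewrite !ffunE merge_lo merge_hi; case: (z k).
rewrite /bit_error sum_rows; apply: eq_bigr => p _.
under eq_bigr => q _.
  under [X in csum X]eq_fun do rewrite !bit_likelihood_lo rlo_merge.
  over.
rewrite (csum_bij _ be) /= sumr_const card_mx card_ord mul1n -[LHS]mulr_natl mulrA; congr (_ * _).
(* The upper half of [p] is irrelevant to the summand; its 2^(2^n) values absorb the difference of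
   the two exponents. *)
have -> : (2 ^ n.+1 - lo i = (2 ^ n - i) + 2 ^ n)%N.
  have -> : lo i = i :> nat by [].
  by rewrite -expn2S addnBAC// ltnW.
by rewrite exprD invfM natrX mulrCA mulfV ?mulr1// expf_neq0// pnatr_eq0.
Qed.

(** The sum over the lower half of [p], reindexed by its codeword, becomes part of the sum over the
    outputs of [transform1]. *)
Lemma bit_error_hi (W : channel R) n (i : 'I_(2 ^ n)) : stochastic W ->
  bit_error W (hi i) = bit_error (transform1 W) i.
Proof.
move=> kW.
pose e (q : {ffun 'I_(2 ^ n.+1) -> out W} * 'rV['F_2]_(2 ^ n)) := halves1 q.1 q.2.
have be : bijective e.
  exists (fun z : {ffun 'I_(2 ^ n) -> out (transform1 W)} =>
                   ([ffun k => merge_halves (fun j => (z j).1.1) (fun j => (z j).1.2) k],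
                    \row_k (z k).2)) => [[y x]|z].
    congr pair; last by apply/rowP => k; rewrite mxE ffunE.
    by apply/ffunP => k; rewrite ffunE; case: (halfP k) => j; rewrite ?merge_lo ?merge_hi ffunE.
  by apply/ffunP => k; rewrite !ffunE merge_lo merge_hi mxE; case: (z k) => -[].
rewrite /bit_error sum_rows exchange_big; apply: eq_bigr => p _ /=.
have -> : (2 ^ n.+1 - (2 ^ n + i) = 2 ^ n - i)%N by rewrite -expn2S subnDl.
rewrite -mulr_sumr; congr (_ * _).
have [s hs] := has_csum_bit_loss i p (stochastic_transform true kW).
rewrite (has_csumE hs); have [g hg hgs] := has_csum_pairP ((has_csum_bij _ _ be).1 hs).
rewrite (has_csum_uniq hgs (has_csum_fin (fun x => has_csum_ge0 (hg x)))).
rewrite [RHS](reindex_inj (can_inj (@encodeK n))); apply: eq_bigr => q _.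
rewrite -(has_csumE (hg _)); congr csum; apply: funext => y.
by rewrite !bit_likelihood_hi rlo_merge rhi_merge.
Qed.

Lemma bit_error0 (W : channel R) (i : 'I_(2 ^ 0)) : bit_error W i = error_prob W.
Proof.
pose e (x : out W) : {ffun 'I_(2 ^ 0) -> out W} := [ffun=> x].
have be : bijective e.
  exists (fun f : {ffun 'I_(2 ^ 0) -> out W} => f ord0) => [x|f]; first by rewrite ffunE.
  by apply/ffunP => k; rewrite ffunE [k]ord1.
have L (x : out W) p v : bit_likelihood i (e x) p v = W v x.
  rewrite /bit_likelihood subnn expr0 invr1 mul1r.
  rewrite (big_pred1 (\row__ v)) => [|u].
    by rewrite encode0E /block_trans big_ord1 mxE ffunE.
  have -> : [forall j : 'I_(2 ^ 0), (j < i)%N ==> (u 0 j == p 0 j)].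
    by apply/forallP => j; rewrite [i]ord1.
  rewrite andbT; apply/eqP/eqP => [<-|->]; last by rewrite mxE.
  by apply/rowP => j; rewrite mxE [j]ord1 [i]ord1.
rewrite /bit_error.
under eq_bigr => p _.
  rewrite (csum_bij _ be).
  under [X in csum X]eq_fun do rewrite !L.
  over.
rewrite /= sumr_const card_mx card_ord mul1n -[LHS]mulr_natl mulrA.
have -> : (2 ^ 0 - i = 1)%N by rewrite [i]ord1.
by rewrite -error_probE expn0 !expr1 mulfV ?mul1r// pnatr_eq0.
Qed.

Lemma bit_errorE (W : channel R) n (i : 'I_(2 ^ n)) : stochastic W ->
  bit_error W i = error_prob (polar_channel W n i).
Proof.
elim: n W i => [|n IH] W i kW; first exact: bit_error0.
case: (halfP i) => j.
  by rewrite bit_error_lo IH ?(polar_channelS0 W (ltn_ord j))//; exact: (stochastic_transform false).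
by rewrite bit_error_hi// IH ?(polar_channelS1 W (ltn_ord j))//; exact: (stochastic_transform true).
Qed.

End BitError.

(** * Successive cancellation decoding *)

Section Decoder.
Variables (R : realType) (W : channel R) (n : nat).
Local Notation N := (2 ^ n)%N.
Implicit Types (A : {set 'I_N}) (y : {ffun 'I_N -> out W}) (c p u v : 'rV['F_2]_N) (i : 'I_N).

Lemma eq_bit_likelihood i y p u (b : 'F_2) : (forall j : 'I_N, (j < i)%N -> p 0 j = u 0 j) ->
  bit_likelihood i y p b = bit_likelihood i y u b.
Proof.
move=> pu; congr (_ * _); apply: eq_bigl => v; congr (_ && _).
by apply/forallP/forallP => h j; have := h j; case: ltnP => //= ji; rewrite pu.
Qed.

Lemma eq_sc_bit A y c p u i : (forall j : 'I_N, (j < i)%N -> p 0 j = u 0 j) ->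
  sc_bit A y c p i = sc_bit A y c u i.
Proof. by move=> pu; rewrite /sc_bit !(eq_bit_likelihood _ _ pu). Qed.

(** If every decision taken with the true past is right, the decoded prefix never leaves [u]. *)
Lemma sc_decode_correct A y c u :
  (forall i, sc_bit A y c u i = u 0 i) -> sc_decode A y c = u.
Proof.
move=> cu.
have prefix k : (k <= N)%N -> forall j : 'I_N, (j < k)%N ->
    foldl (sc_step A y c) 0 (take k (enum 'I_N)) 0 j = u 0 j.
  elim: k => [//|k IH] kN j jk.
  have x0 : 'I_N := Ordinal kN.
  rewrite (take_nth x0) ?size_enum_ord// -cats1 foldl_cat /=.
  set i := nth x0 _ _; have ik : i = k :> nat by rewrite nth_enum_ord.
  rewrite mxE; case: eqVneq => [->|ji].
    rewrite (@eq_sc_bit _ _ _ _ u) ?cu// => l; rewrite ik => lk.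
    by apply: IH => //; exact: ltnW.
  apply: IH; first exact: ltnW.
  by rewrite ltn_neqAle -ltnS jk andbT -ik; apply: contraNneq ji => /val_inj ->.
apply/rowP => j; rewrite -(prefix N) ?ltn_ord//.
by rewrite /sc_decode take_oversize// size_enum_ord.
Qed.

(** Flipping the coin at [i] permutes the coin vectors, so the sum equals its average with the
    flipped one. *)
Lemma sum_coin i (f : 'F_2 -> R) :
  \sum_(c : 'rV['F_2]_N) 2 ^- N * f (c 0 i) = 2^-1 * (f 0 + f 1).
Proof.
have E : \sum_(c : 'rV['F_2]_N) f (c 0 i) = \sum_(c : 'rV['F_2]_N) f (c 0 i + 1).
  rewrite (reindex_inj (addIr (delta_mx 0 i))); apply: eq_bigr => c _.
  by rewrite !mxE !eqxx.
have {E} : 2 * \sum_(c : 'rV['F_2]_N) f (c 0 i) = 2 ^+ N * (f 0 + f 1).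
  rewrite mulr_natl mulr2n {2}E -big_split/=.
  rewrite (eq_bigr (fun=> f 0 + f 1)) => [|c _].
    by rewrite sumr_const card_mx card_ord mul1n -[LHS]mulr_natl natrX.
  by case: (F2_cases (c 0 i)) => ->; rewrite ?add0r ?F2_11// addrC.
rewrite -mulr_sumr => E.
have {E} -> : \sum_(c : 'rV['F_2]_N) f (c 0 i) = 2^-1 * (2 ^+ N * (f 0 + f 1)).
  by rewrite -E mulKf// pnatr_eq0.
by rewrite mulrCA mulKf// expf_neq0// pnatr_eq0.
Qed.

Definition bit_loss y u i : R :=
  tie_loss (bit_likelihood i y u (u 0 i + 1)) (bit_likelihood i y u (u 0 i)).

Lemma sum_coin_sc_bit A y u i : i \in A ->
  \sum_(c : 'rV['F_2]_N) 2 ^- N * (sc_bit A y c u i != u 0 i)%:R = bit_loss y u i.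
Proof.
move=> iA; pose f (b : 'F_2) : R := ((if bit_likelihood i y u 1 < bit_likelihood i y u 0 then 0
  else if bit_likelihood i y u 0 < bit_likelihood i y u 1 then 1 else b) != u 0 i)%:R.
rewrite (eq_bigr (fun c => 2 ^- N * f (c 0 i))) => [|c _]; last by rewrite /sc_bit iA.
rewrite sum_coin /f /bit_loss /tie_loss.
case: (F2_cases (u 0 i)) => ->; rewrite ?add0r ?F2_11.
  by case: ltgtP => _; rewrite /= ?mulr0 ?addr0 ?add0r ?mulr1 ?addrr; lra.
by case: ltgtP => _; rewrite /= ?mulr0 ?addr0 ?add0r ?mulr1; lra.
Qed.

(* At the first wrong decision the decoder knows the true past. *)
Lemma sum_coin_decode_le A y u : frozen A u ->
  \sum_(c : 'rV['F_2]_N) 2 ^- N * (sc_decode A y c != u)%:R <= \sum_(i in A) bit_loss y u i.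
Proof.
move=> /forallP fu.
under [leRHS]eq_bigr => i iA do rewrite -(sum_coin_sc_bit y u iA).
rewrite exchange_big /=; apply: ler_sum => c _; rewrite -mulr_sumr.
rewrite ler_wpM2l ?invr_ge0 ?exprn_ge0//.
have [_|ne] := eqVneq (sc_decode A y c) u; first by rewrite sumr_ge0.
have /existsP[i] : [exists i, sc_bit A y c u i != u 0 i].
  apply: contraNT ne; rewrite negb_exists => /forallP h.
  by apply/eqP/sc_decode_correct => i; have := h i; rewrite negbK => /eqP.
move=> hi; have iA : i \in A.
  apply: contraNT hi => iA; rewrite /sc_bit iA eq_sym.
  by have := fu i; rewrite iA.
by rewrite (bigD1 i)//= hi lerDl sumr_ge0.
Qed.

Hypothesis bW : bms W.
Let kW : stochastic W := bms_stochastic bW.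

Definition genie_error u i : R :=
  csum (fun y => block_trans (encode u) y * bit_loss y u i).

Lemma has_csum_genie u i :
  has_csum (fun y => block_trans (encode u) y * bit_loss y u i) (genie_error u i).
Proof.
have B y : 0 <= block_trans (encode u) y * bit_loss y u i <= block_trans (encode u) y.
  have T0 := block_trans_ge0 (encode u) y kW.
  have /andP[l0 l1] : 0 <= bit_loss y u i <= 1 by exact: tie_loss_itv.
  by rewrite mulr_ge0//= -[leRHS]mulr1 ler_wpM2l.
have [s hs _] := has_csum_dominated B (has_csum_block_trans (encode u) kW).
by rewrite /genie_error (has_csumE hs).
Qed.

(* Applying the involution of the output alphabet where [encode v] is 1 turns
   the transmission of [u] into that of [u + v]. *)
Lemma genie_error_shift u v i : genie_error (u + v) i = genie_error u i.
Proof.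
have [_ _ [pi piK pi1]] := bW.
pose s y : {ffun 'I_N -> out W} := [ffun k => if encode v 0 k == 1 then pi (y k) else y k].
have sK : involutive s.
  by move=> y; apply/ffunP => k; rewrite !ffunE; case: (encode v 0 k == 1) => //; rewrite piK.
have Ts w y : block_trans (encode (w + v)) (s y) = block_trans (encode w) y.
  apply: eq_bigr => k _; rewrite encodeD mxE ffunE.
  case: (F2_cases (encode v 0 k)) => ->; first by rewrite addr0.
  case: (F2_cases (encode w 0 k)) => ->; rewrite eqxx ?add0r ?F2_11 ?pi1 ?piK//.
have Ls w y b : bit_likelihood i (s y) (w + v) (b + v 0 i) = bit_likelihood i y w b.
  rewrite /bit_likelihood; congr (_ * _).
  rewrite (reindex_inj (addIr v)); apply: eq_big => [x|x _]; last exact: Ts.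
  rewrite mxE (inj_eq (addIr _)); congr (_ && _).
  by apply/forallP/forallP => h j; have := h j; rewrite !mxE (inj_eq (addIr _)).
rewrite /genie_error (csum_bij _ (inv_bij sK)); congr csum; apply: funext => y.
rewrite Ts; congr (_ * _); rewrite /bit_loss mxE.
by rewrite [_ + v 0 i + 1]addrAC !Ls.
Qed.

Lemma genie_error_const u v i : genie_error u i = genie_error v i.
Proof. by rewrite -(genie_error_shift v (v + u)) [v + (v + u)]addrC [v + u]addrC rowF2_addK. Qed.

Lemma card_agree i (p : 'rV['F_2]_N) :
  #|[pred u : 'rV['F_2]_N | (u 0 i == 1) &&
     [forall j : 'I_N, (j < i)%N ==> (u 0 j == p 0 j)]]|%:R = 2 ^+ (N - i.+1) :> R.
Proof.
pose D (j : 'I_N) (x : 'F_2) : R :=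
  (if (j < i)%N then x == p 0 j else if j == i then x == 1 else true)%:R.
rewrite -sum1_card natr_sum big_mkcond /=.
transitivity (\prod_j \sum_x D j x).
  rewrite prod_sum_F2; apply: eq_bigr => u _.
  case: ifP => [/andP[/eqP ui /forallP up]|].
    rewrite big1// => j _; rewrite /D; have := up j.
    by case: ltnP => //= _ => [->//|_]; case: eqVneq => // ->; rewrite ui eqxx.
  move=> /negbT; rewrite negb_and negb_forall => /orP[ui|/existsP[j]].
    by rewrite (bigD1 i)//= /D ltnn eqxx (negPf ui) mul0r.
  by rewrite negb_imply => /andP[ji uj]; rewrite (bigD1 j)//= /D ji (negPf uj) mul0r.
rewrite (eq_bigr (fun j : 'I_N => if (i < j)%N then 2 else 1)) => [|j _]; last first.
  rewrite sum_F2 /D; case: (ltngtP j i) => [ji|ij|/val_inj ->].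
  - by case: (F2_cases (p 0 j)) => ->; rewrite /= ?addr0 ?add0r.
  - by rewrite (negPf (_ : j != i))//; apply: contraTneq ij => ->; rewrite ltnn.
  - by rewrite eqxx /= add0r.
rewrite -big_mkcond /= -prodr_const_nat big_geq_mkord.
exact: eq_bigl.
Qed.

(** [bit_error] averages [genie_error] over the words with bit 1 at [i], and by [genie_error_const]
    all of these agree. The 2^N rows [p], the 2^(N-i-1) words agreeing with each of them and the two
    normalizations multiply to 1. *)
Lemma genie_errorE u i : genie_error u i = bit_error W i.
Proof.
rewrite /bit_error.
pose a : R := 2 ^- (N - 1).
have E (p : 'rV['F_2]_N) : csum (fun y => bit_likelihood (W := W) i y p 1 *
      tie_loss (bit_likelihood i y p 0) (bit_likelihood i y p 1)) =
    a * (2 ^+ (N - i.+1) * genie_error u i).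
  apply: has_csumE.
  have -> : 2 ^+ (N - i.+1) * genie_error u i = \sum_(v : 'rV['F_2]_N | (v 0 i == 1) &&
     [forall j : 'I_N, (j < i)%N ==> (v 0 j == p 0 j)]) genie_error v i.
    rewrite -(card_agree i p) (eq_bigr (fun=> genie_error u i)) => [|v _].
      by rewrite sumr_const -[RHS]mulr_natl.
    exact: genie_error_const.
  have a0 : 0 <= a by rewrite invr_ge0 exprn_ge0.
  apply: eq_has_csum (has_csumZ a0 (has_csum_sum _ _ (fun v => has_csum_genie v i))) => y.
  rewrite -mulrA mulr_suml; congr (_ * _); apply: eq_bigr => v /andP[/eqP vi /forallP vp].
  have pv (j : 'I_N) : (j < i)%N -> p 0 j = v 0 j by move=> ji; have := vp j; rewrite ji => /eqP ->.
  by rewrite /bit_loss vi F2_11 !(eq_bit_likelihood _ _ pv).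
rewrite (eq_bigr _ (fun p _ => congr1 _ (E p))).
rewrite sumr_const card_mx card_ord mul1n -[RHS]mulr_natl natrX /a.
have e1 : (2 ^+ N : R) = 2 * 2 ^+ (N - 1).
  by rewrite -exprS subn1 prednK// expn_gt0.
have e2 : (2 ^+ (N - i) : R) = 2 * 2 ^+ (N - i.+1).
  by rewrite -exprS -subSn.
have z k : (2 ^+ k : R) != 0 by rewrite expf_neq0// pnatr_eq0.
rewrite e1 e2; move: (z (N - 1)%N) (z (N - i.+1)%N); move: (2 ^+ (N - 1)) (2 ^+ (N - i.+1)) => x t x0 t0.
by field; rewrite x0 t0.
Qed.

Lemma card_frozen A : #|[pred u | frozen A u]|%:R = 2 ^+ #|A| :> R.
Proof.
pose D (j : 'I_N) (x : 'F_2) : R := ((j \notin A) ==> (x == 0))%:R.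
rewrite -[in LHS]sum1_card natr_sum big_mkcond /=.
transitivity (\prod_j \sum_x D j x).
  rewrite prod_sum_F2; apply: eq_bigr => u _; rewrite inE.
  case: ifP => [/forallP fu|/negbT]; first by rewrite big1// => j _; rewrite /D fu.
  by rewrite negb_forall => /existsP[j uj]; rewrite (bigD1 j)//= /D (negPf uj) mul0r.
rewrite (eq_bigr (fun j => if j \in A then 2 else 1)) => [|j _].
  by rewrite -big_mkcond /= prodr_const.
by rewrite sum_F2 /D; case: (j \in A); rewrite /= ?addr0.
Qed.

Lemma block_error_le A :
  block_error W A <= \sum_(i in A) error_prob (polar_channel W n i).
Proof.
have le1 u : frozen A u ->
    \sum_(c : 'rV['F_2]_N) 2 ^- N *
    csum (fun y => block_trans (encode u) y * (sc_decode A y c != u)%:R)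
    <= \sum_(i in A) error_prob (polar_channel W n i).
  move=> fu; rewrite (eq_bigr (fun i => genie_error u i)) => [|i _]; last first.
    by rewrite genie_errorE bit_errorE.
  have h0 : 0 <= 2 ^- N :> R by rewrite invr_ge0 exprn_ge0.
  have hc c : has_csum (fun y => block_trans (encode u) y * (sc_decode A y c != u)%:R)
      (csum (fun y => block_trans (encode u) y * (sc_decode A y c != u)%:R)).
    have B y : 0 <= block_trans (encode u) y * (sc_decode A y c != u)%:R <= block_trans (encode u) y.
      have T0 := block_trans_ge0 (encode u) y kW.
      by case: (_ != _); rewrite /= ?mulr1 ?mulr0 T0 lexx.
    have [s hs _] := has_csum_dominated B (has_csum_block_trans (encode u) kW).
    by rewrite (has_csumE hs).
  apply: le_has_csum (has_csum_sum _ _ (fun c => has_csumZ h0 (hc c)))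
    (has_csum_sum _ _ (fun i => has_csum_genie u i)) _ => y.
  rewrite -[leRHS]mulr_sumr; under [leLHS]eq_bigr do rewrite mulrCA.
  rewrite -[leLHS]mulr_sumr ler_wpM2l ?block_trans_ge0//.
  exact: sum_coin_decode_le.
rewrite /block_error -mulr_sumr.
have z : (0 : R) < 2 ^+ #|A| by rewrite exprn_gt0.
rewrite mulrC ler_pdivrMr//; apply: le_trans (ler_sum _ le1) _.
by rewrite sumr_const -[leLHS]mulr_natl card_frozen mulrC.
Qed.

End Decoder.

(** An index of [A] above [e] would force every index below [e] into the rest of [A], leaving fewer
    than ceil(N r) of them. *)
Lemma info_set_error_le (R : realType) (W : channel R) (n : nat) (r e : R)
    (A : {set 'I_(2 ^ n)}) :
  (2 ^ n)%:R * r <=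
    #|[set i : 'I_(2 ^ n) | error_prob (polar_channel W n i) <= e]|%:R ->
  info_set W r A -> forall i, i \in A -> error_prob (polar_channel W n i) <= e.
Proof.
set B := [set i | _] => rB [cA leA] i iA; rewrite leNgt; apply/negP => ei.
have BA : B \subset A :\ i.
  apply/fintype.subsetP => j; rewrite !inE => jB; apply/andP; split.
    by apply: contraTneq jB => ->; rewrite -ltNge.
  apply: contraTT jB => jA; rewrite -ltNge; exact: lt_le_trans ei (leA i j iA jA).
have : (#|A| <= #|B|)%N by rewrite -lez_nat cA ceil_le_int.
by rewrite leqNgt (leq_ltn_trans (subset_leq_card BA))// [X in (_ < X)%N](cardsD1 i) iA.
Qed.

Theorem corollary19 (R : realType) (Pe C : R) (hPe : 0 < Pe) :
  exists2 beta : R, 0 < beta &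
    forall W : channel R, bms W -> capacity W = C ->
    forall r : R, 0 < r < capacity W ->
    exists n : nat,
      (2 ^ n)%:R <= beta / (capacity W - r) ^+ 6 /\
      forall A : {set 'I_(2 ^ n)}, info_set W r A -> block_error W A <= Pe.
Proof.
have [c c0 good] := good_indices hPe.
have [beta beta0 len] := blocklength_exists c0.
exists beta => // W bW _ r /andP[r0 rI].
(* Puts [capacity W - r] in the range ]0, 1] that [len] requires. *)
have I1 : capacity W <= 1.
  by rewrite sym_capacityE// sym_capacity_le1//; exact: bms_stochastic.
have [|n [nle cn]] := len (capacity W - r).
  by rewrite subr_gt0 rI lerBlDr (le_trans I1)// lerDl ltW.
exists n; split=> // A infoA.
have rle : r <= capacity W - c * (57 / 64) ^+ n by rewrite lerBrDr addrC -lerBrDr.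
have N0 : (0 : R) < (2 ^ n)%:R by rewrite ltr0n expn_gt0.
apply: le_trans (block_error_le bW A) _.
apply: le_trans (ler_sum _ (info_set_error_le (good W n r bW rle) infoA)) _.
rewrite sumr_const -[leLHS]mulr_natl mulrCA -[leRHS]mulr1 ler_pM2l//.
rewrite ler_pdivrMr// mul1r ler_nat.
by rewrite -[leqRHS]card_ord max_card.
Qed.
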